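(* Let $k$ be a field with $\mathrm{char}\,k\ne2$, let $a\in k^\times$ and $\varepsilon\in\{1,-1\}$, and let $G=\langle\tau,\lambda,\sigma\rangle\simeq A_4$ act on the rational function field $k(x_1,x_2,x_3)$ by the $k$-automorphisms $\tau: x_1\mapsto \frac{a}{x_1},\ x_2\mapsto\varepsilon\frac{a}{x_2},\ x_3\mapsto\varepsilon x_3$; $\lambda: x_1\mapsto\varepsilon\frac{a}{x_1},\ x_2\mapsto\varepsilon x_2,\ x_3\mapsto\frac{a}{x_3}$; $\sigma: x_1\mapsto x_2,\ x_2\mapsto x_3,\ x_3\mapsto x_1$. (1) If $\varepsilon=1$, then $k(x_1,x_2,x_3)^G$ is $k$-rational. (2) If $\varepsilon=-1$ and $[k(\sqrt a,\sqrt{-1}):k]\le2$, then $k(x_1,x_2,x_3)^G$ is $k$-rational.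
   Context: $A_4$ is the alternating group of degree $4$. A field is $k$-rational if it is purely transcendental over $k$. *)

(* Defs.v *)
From HB Require Import structures.
From mathcomp Require Import all_boot all_order all_algebra all_field.
Set Implicit Arguments. Unset Strict Implicit. Unset Printing Implicit Defensive.
Import GRing.Theory.
Local Open Scope ring_scope.

Notation RF3 k := {fraction {poly {poly {poly k}}}}.

Definition cst (k : fieldType) (c : k) : RF3 k :=
  FracField.tofrac (c%:P%:P%:P).
Definition X1 (k : fieldType) : RF3 k := FracField.tofrac ('X%:P%:P).
Definition X2 (k : fieldType) : RF3 k := FracField.tofrac ('X%:P).
Definition X3 (k : fieldType) : RF3 k := FracField.tofrac 'X.

Definition fixes_k (k : fieldType) (f : RF3 k -> RF3 k) : Prop :=
  forall c : k, f (cst c) = cst c.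

(* A subfield F (given as a predicate) of k(x1,x2,x3) is k-rational
   (purely transcendental over k): it is the image of a k-embedding of a
   rational function field k(t1,t2,t3).  (A subfield of k(x1,x2,x3) of finite
   index, like a fixed field of a finite group, has transcendence degree 3, so
   the number of variables must be 3.) *)
Definition k_rational (k : fieldType) (F : RF3 k -> Prop) : Prop :=
  exists phi : {rmorphism RF3 k -> RF3 k},
    fixes_k phi /\ (forall f, F f <-> exists g, phi g = f).

(* [k(sqrt a, sqrt -1) : k] <= 2 : in some (finite) extension field L of k
   containing square roots s of a and i of -1, the subfield k(s,i) generated
   by them has k-dimension <= 2 (this degree does not depend on the choice). *)
Definition deg_sqrt_a_i_le2 (k : fieldType) (a : k) : Prop :=
  exists (L : fieldExtType k) (s i : L),
    s ^+ 2 = a%:A /\ i ^+ 2 = - 1 /\ (\dim <<1 & [:: s; i]>>%VS <= 2)%N.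

(* Main.v *)
(** Write K = k(x1,x2,x3).  For each sign we exhibit y1, y2, y3 in K, permuted
    cyclically by sigma, that generate the fixed field of <tau, lambda>; Masuda's
    formula then gives generators of k(y1,y2,y3)^<sigma>.  All algebraic
    independence statements follow from Steinitz exchange, since in every step K
    is algebraic over the three elements considered.

    For epsilon = 1 the y_i are obtained by descent from k(sqrt a): in the
    coordinates (x_i - sqrt a)/(x_i + sqrt a) the Klein group acts by signs.

    For epsilon = -1 one of a, -a, -1 is a square, and K is generated by three
    points (p_i, q_i) on the conic p^2 + q^2 + d = 0, on which the Klein group
    acts by sign changes, for some d in k such that -2d = r^2 + s^2.  There are
    vectors a, b, c with cubic coordinates in the p_i, q_i, permuted by sigma, all
    of whose coordinates have the same sign character, and with
    B(a,b) = B(b,c) = B(c,a) = 0 for the bilinear form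
    B(u,v) = d u1 v1 + u2 v2 + u3 v3 + u2 v3 - u3 v2.  The threefold of such
    triples in (P^2)^3 is the quotient by the Klein group.  The quadric B(u,u) = 0
    has a rational point, and projecting a, b and c from it yields y1, y2, y3:
    given the three lines, the positions of a, b, c on them are found from three
    linear equations. *)

Require Import Defs.
From HB Require Import structures.
From mathcomp Require Import all_boot all_order all_algebra all_field.
From mathcomp Require Import ring.
From mathcomp Require Import boolp.
Set Implicit Arguments. Unset Strict Implicit. Unset Printing Implicit Defensive.
Import GRing.Theory.
Local Open Scope ring_scope.

(** * Generated subfields and algebraic closures inside a field *)


Section GeneratedSubfield.
Variables (k K : fieldType) (iota : {rmorphism k -> K}).

(** An inductive form of the subfield generated by [S] over the image of [k], so that membership is
    used by induction on field expressions. As [0^-1 = 0], closure under inverses carries no side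
    condition. *)
Inductive gen (S : seq K) : K -> Prop :=
| gen_cst c : gen S (iota c)
| gen_mem x : x \in S -> gen S x
| genN x : gen S x -> gen S (- x)
| genD x y : gen S x -> gen S y -> gen S (x + y)
| genM x y : gen S x -> gen S y -> gen S (x * y)
| genV x : gen S x -> gen S x^-1.

Definition genb (S : seq K) : {pred K} := fun x => `[< gen S x >].

Lemma genbP S x : reflect (gen S x) (x \in genb S).
Proof. exact: asboolP. Qed.

Lemma gen0 S : gen S 0.
Proof. by rewrite -(rmorph0 iota); apply: gen_cst. Qed.

Lemma gen1 S : gen S 1.
Proof. by rewrite -(rmorph1 iota); apply: gen_cst. Qed.

Lemma genB S x y : gen S x -> gen S y -> gen S (x - y).
Proof. by move=> Sx /genN; apply: genD. Qed.

Lemma gen_div S x y : gen S x -> gen S y -> gen S (x / y).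
Proof. by move=> Sx /genV; apply: genM. Qed.

Lemma gen_nat S n : gen S n%:R.
Proof. by rewrite -(rmorph_nat iota); apply: gen_cst. Qed.

Lemma genX S x n : gen S x -> gen S (x ^+ n).
Proof.
move=> Sx; elim: n => [|n IH]; first by rewrite expr0; apply: gen1.
by rewrite exprS; apply: genM.
Qed.

Lemma gen_trans S T x : {in S, forall y, gen T y} -> gen S x -> gen T x.
Proof.
move=> ST; elim=> [c|y /ST|y _|y z _ Ty _|y z _ Ty _|y _] //;
  [exact: gen_cst|exact: genN|exact: genD|exact: genM|exact: genV].
Qed.

Lemma gen_sub S T x : {subset S <= T} -> gen S x -> gen T x.
Proof. by move=> ST; apply: gen_trans => y /ST; apply: gen_mem. Qed.

Fact genb_divring S : divring_closed (genb S).
Proof.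
split=> [|x y /genbP Sx /genbP Sy|x y /genbP Sx /genbP Sy]; apply/genbP.
- exact: gen1.
- exact: genB.
- exact: gen_div.
Qed.
HB.instance Definition _ S :=
  GRing.isDivringClosed.Build K (genb S) (genb_divring S).

(** [gen S] packaged as a field type, so that [algebraicOver] can speak of algebraicity over it. *)
Record subgen (S : seq K) := Subgen { subgen_val : K; _ : subgen_val \in genb S }.
HB.instance Definition _ S := [isSub for @subgen_val S].
HB.instance Definition _ S := [Choice of subgen S by <:].
HB.instance Definition _ S := [SubChoice_isSubComUnitRing of subgen S by <:].
HB.instance Definition _ S :=
  [SubComUnitRing_isSubIntegralDomain of subgen S by <:].
HB.instance Definition _ S := [SubIntegralDomain_isSubField of subgen S by <:].

Definition alg (S : seq K) (x : K) :=
  algebraicOver (val : {rmorphism subgen S -> K}) x.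

Lemma alg_gen S x : gen S x -> alg S x.
Proof.
move=> Sx; have Sx' : x \in genb S by apply/genbP.
by rewrite -[x]/(val (Subgen Sx')); apply: algebraic_id.
Qed.

Lemma algP S x :
  alg S x <-> exists2 p : {poly K}, p != 0 & (forall i, gen S p`_i) /\ root p x.
Proof.
split=> [[p p0 px]|[p p0 [Sp px]]].
  exists (map_poly val p); first by rewrite map_poly_eq0.
  by split=> // i; rewrite coef_map; apply/genbP/valP.
pose q := map_poly (insubd (0 : subgen S)) p.
have qE : map_poly val q = p.
  apply/polyP => i; rewrite coef_map coef_map_id0 /=.
    by rewrite insubdK //; apply/genbP.
  apply/val_inj; rewrite insubdK //; exact/genbP/gen0.
exists q; last by rewrite qE.
by rewrite -(map_poly_eq0 (val : {rmorphism subgen S -> K})) qE.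
Qed.

Lemma algN S x : alg S x -> alg S (- x). Proof. exact: algebraic_opp. Qed.
Lemma algD S x y : alg S x -> alg S y -> alg S (x + y).
Proof. exact: algebraic_add. Qed.
Lemma algM S x y : alg S x -> alg S y -> alg S (x * y).
Proof. exact: algebraic_mul. Qed.
Lemma algV S x : alg S x -> alg S x^-1. Proof. exact: algebraic_inv. Qed.

Lemma algX S x n : alg S x -> alg S (x ^+ n).
Proof.
move=> Sx; elim: n => [|n IH]; first by rewrite expr0; apply/alg_gen/gen1.
by rewrite exprS; apply: algM.
Qed.

Lemma alg_cst S c : alg S (iota c). Proof. exact/alg_gen/gen_cst. Qed.
Lemma alg_mem S x : x \in S -> alg S x.
Proof. by move=> Sx; exact/alg_gen/gen_mem. Qed.

(** The step behind transitivity: over a field algebraic and integral elements coincide, and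
    integrality passes from coefficients to roots. *)
Lemma alg_root S (p : {poly K}) x :
  p != 0 -> (forall i, alg S p`_i) -> root p x -> alg S x.
Proof.
move=> p0 Sp px; apply/integral_algebraic.
apply: (integral_root p0 px); apply/integral_poly => i.
by have /integral_algebraic := Sp i.
Qed.

Lemma alg_trans S T x : {in S, forall y, alg T y} -> alg S x -> alg T x.
Proof.
move=> ST /algP [p p0 [Sp px]]; apply: alg_root p0 _ px => i.
elim: (Sp i) => [c|y /ST|y _|y z _ Ty _|y z _ Ty _|y _] //;
  [exact: alg_cst|exact: algN|exact: algD|exact: algM|exact: algV].
Qed.

Lemma alg_sub S T x : {subset S <= T} -> alg S x -> alg T x.
Proof. by move=> ST; apply: alg_trans => y /ST; apply: alg_mem. Qed.

Lemma gen_alg S T x : {in S, forall y, alg T y} -> gen S x -> alg T x.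
Proof. by move=> ST /alg_gen; apply: alg_trans. Qed.

End GeneratedSubfield.

Ltac gen_tac := repeat match goal with
  | |- _ => assumption
  | |- gen _ _ (_ + _) => apply: genD
  | |- gen _ _ (_ * _) => apply: genM
  | |- gen _ _ (- _) => apply: genN
  | |- gen _ _ (_ ^-1) => apply: genV
  | |- gen _ _ (_ ^+ _) => apply: genX
  | |- gen _ _ 0 => exact: gen0
  | |- gen _ _ 1 => exact: gen1
  | |- gen _ _ (_%:R) => exact: gen_nat
  end.

Ltac alg_tac := repeat match goal with
  | |- _ => assumption
  | |- alg _ _ (_ + _) => apply: algD
  | |- alg _ _ (_ * _) => apply: algM
  | |- alg _ _ (- _) => apply: algN
  | |- alg _ _ (_ ^-1) => apply: algV
  | |- alg _ _ (_ ^+ _) => apply: algX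
  | |- alg _ _ 0 => exact/alg_gen/gen0
  | |- alg _ _ 1 => exact/alg_gen/gen1
  | |- alg _ _ (_%:R) => exact/alg_gen/gen_nat
  end.

(** * Steinitz exchange *)


Section Fractions.
Variables (R : nzRingType) (K : fieldType) (f : {rmorphism R -> K}).

Definition is_frac (x : K) := exists n d, f d != 0 /\ x = f n / f d.

Lemma frac_img r : is_frac (f r).
Proof. by exists r, 1; rewrite rmorph1 oner_neq0 divr1. Qed.

Lemma fracN x : is_frac x -> is_frac (- x).
Proof. by case=> n [d [d0 ->]]; exists (- n), d; rewrite rmorphN mulNr. Qed.

Lemma fracD x y : is_frac x -> is_frac y -> is_frac (x + y).
Proof.
case=> n [d [d0 ->]] [m [e [e0 ->]]].
by exists (n * e + m * d), (d * e); rewrite rmorphD !rmorphM mulf_neq0 ?addf_div.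
Qed.

Lemma fracM x y : is_frac x -> is_frac y -> is_frac (x * y).
Proof.
case=> n [d [d0 ->]] [m [e [e0 ->]]].
by exists (n * m), (d * e); rewrite !rmorphM mulf_neq0 ?mulf_div.
Qed.

Lemma fracV x : is_frac x -> is_frac x^-1.
Proof.
case=> n [d [d0 ->]]; have [n0|n0] := eqVneq (f n) 0.
  by rewrite n0 mul0r invr0 -(rmorph0 f); apply: frac_img.
by exists d, n; rewrite n0 invf_div.
Qed.

(** Induction on [p]: the constant coefficient is some [n / d], and the scalar already found for the
    rest is multiplied by [d]. *)
Lemma clear_denominators (p : {poly K}) :
  (forall i, is_frac p`_i) ->
  exists c (q : {poly R}), f c != 0 /\ map_poly f q = f c *: p.
Proof.
elim/poly_ind: p => [_|p a IH Hp].
  by exists 1, 0; rewrite rmorph1 oner_neq0 map_poly0 scaler0.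
have [i|c [q [c0 qE]]] := IH.
  by have := Hp i.+1; rewrite coefD coefMX coefC /= addr0.
have := Hp 0; rewrite coefD coefMX coefC /= add0r => -[n [d [d0 aE]]].
exists (d * c), (d%:P * q * 'X + (c * n)%:P); rewrite !rmorphM mulf_neq0 //.
split=> //; rewrite rmorphD !rmorphM /= map_polyX !map_polyC /= qE.
have cdE : f d * f c = f c * f d.
  by rewrite mulrC.
rewrite scalerDr aE -!mul_polyC !polyCM; congr (_ + _).
  by rewrite !mulrA.
have -> : (f d)%:P * (f c)%:P * ((f n)%:P * (f d)^-1%:P) =
   (f c)%:P * (f n)%:P * ((f d)%:P * (f d)^-1%:P) :> {poly K}.
  by rewrite [(f d)%:P * _]mulrC -!mulrA; congr (_ * _); rewrite mulrCA.
by rewrite -[X in _ = _ * X]polyCM mulfV // mulr1 -polyCM.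
Qed.

End Fractions.

Section Steinitz.
Variables (k K : fieldType) (iota : {rmorphism k -> K}).
Local Notation gen := (gen iota).
Local Notation alg := (alg iota).

Lemma gen_frac (R : nzRingType) (f : {rmorphism R -> K}) (S : seq K) x :
  (forall c, exists r, f r = iota c) -> {in S, forall y, is_frac f y} ->
  gen S x -> is_frac f x.
Proof.
move=> fk fS; elim=> [c|y /fS|y _|y z _ fy _|y z _ fy _|y _] //.
- by have [r <-] := fk c; apply: frac_img.
- exact: fracN.
- exact: fracD.
- exact: fracM.
- exact: fracV.
Qed.

(** Clearing denominators turns the equation of [b] over [a :: S] into a bivariate relation over
    [gen S]. Read as a polynomial in [a], it has coefficients in [gen (b :: S)], and it is nonzero
    because [b] is transcendental over [S]. *)
Lemma alg_exchange (S : seq K) a b :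
  alg (a :: S) b -> ~ alg S b -> alg (b :: S) a.
Proof.
move=> /algP [p p0 [Sp pb]] Sb.
pose v : {rmorphism subgen iota S -> K} := val.
pose ev x : {rmorphism {poly subgen iota S} -> K} := horner_eval x \o map_poly v.
have evC x c : ev x c%:P = v c by rewrite /= /horner_eval (map_polyC v) hornerC.
have genv c : gen S (v c) by apply/genbP/valP.
have genE y : gen S y -> exists c, v c = y.
  by move=> Sy; have Sy' : y \in genb iota S by [apply/genbP]; exists (Subgen Sy').
(* In [q] the inner variable stands for [a] and the outer one for [b]; [swapXY] exchanges them
   below. *)
have [i|c [q [c0 qE]]] := @clear_denominators _ _ (ev a) p.
  apply: (@gen_frac _ (ev a) (a :: S)) (Sp i) => [d|y].
    by have [e ve] := genE _ (gen_cst iota S d); exists e%:P; rewrite evC.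
  rewrite inE => /predU1P[->|Sy]; last first.
    by have [e <-] := genE _ (gen_mem iota Sy); rewrite -(evC a); apply: frac_img.
  have aE : a = ev a 'X by rewrite /= /horner_eval (map_polyX v) hornerX.
  by rewrite [X in is_frac _ X]aE; apply: frac_img.
have q0 : q != 0.
  apply: contraNneq p0 => q0; move/eqP: qE.
  by rewrite q0 map_poly0 eq_sym scaler_eq0 (negPf c0).
pose Q := map_poly (map_poly v) q.
have mapQ x : map_poly (ev x) q = map_poly (horner_eval x) Q.
  by rewrite /Q -map_poly_comp.
have Qab : Q.[b%:P].[a] = 0.
  rewrite -horner2_swapXY horner_swapXY -mapQ qE hornerZ.
  by rewrite (rootP pb) mulr0.
have evb0 u : u != 0 -> ev b u != 0.
  move=> u0; apply/eqP => ub; apply: Sb; exists u => //.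
  by apply/rootP; rewrite -[RHS]ub.
apply/algP; exists (map_poly (ev b) (swapXY q)).
  by rewrite map_poly_eq0_id0 ?evb0 ?lead_coef_eq0 ?swapXY_eq0.
split=> [i|].
  rewrite coef_map /= horner_evalE horner_coef.
  elim/big_ind: _ => [|x y|j _]; [exact: gen0|exact: genD|apply: genM].
    rewrite (coef_map v); apply: gen_sub (genv _) => y.
    by rewrite inE orbC => ->.
  by apply/genX/gen_mem; rewrite mem_head.
apply/rootP; rewrite -[RHS]Qab horner_polyC.
by rewrite /Q swapXY_map /= -map_poly_comp.
Qed.

(** Each element is transcendental over [B] and its predecessors. These accumulate in reverse order,
    whence the lists [[:: T3; T2; T1]] later on. *)
Fixpoint indep (B xs : seq K) : Prop :=
  if xs is x :: xs' then ~ alg B x /\ indep (x :: B) xs' else True.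

(** Elements are dropped from the front of [S] until [x] ceases to be algebraic; [s] is the last one
    dropped, so it can be exchanged with [x]. *)
Lemma alg_split S B x : ~ alg B x -> alg (S ++ B) x ->
  exists S1 s S2, [/\ S = S1 ++ s :: S2, alg (s :: S2 ++ B) x & ~ alg (S2 ++ B) x].
Proof.
move=> Bx; elim: S => [//|s S IH] /= Sx.
have [/IH [S1 [t [S2 [-> ? ?]]]]|nSx] := pselect (alg (S ++ B) x).
  by exists (s :: S1), t, S2.
by exists [::], s, S.
Qed.

(** At each step [x] moves into [B] and replaces an element [s] of [S], which stays algebraic over
    the new list by [alg_exchange]. Thus [S] loses one element for each element of [xs]. *)
Lemma steinitz xs S B :
  indep B xs -> {in xs, forall x, alg (S ++ B) x} -> (size xs <= size S)%N.
Proof.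
elim: xs S B => [//|x xs IH] S B /= [Bx xs_ind] Sxs.
have [S1 [s [S2 [SE sx S2x]]]] := alg_split Bx (Sxs x (mem_head _ _)).
rewrite SE size_cat /= addnS ltnS -size_cat.
apply: IH xs_ind _ => y xs_y.
have := Sxs y; rewrite inE xs_y orbT SE => /(_ isT).
apply: alg_trans => z; rewrite -catA cat_cons mem_cat inE => Hz.
have [zs|zs] := eqVneq z s; last first.
  apply: alg_mem; move: Hz; rewrite (negPf zs) /= !mem_cat inE.
  by case/or3P => ->; rewrite ?orbT.
rewrite zs; apply: alg_sub (alg_exchange sx S2x) => w.
by rewrite inE !mem_cat inE => /or3P[] ->; rewrite ?orbT.
Qed.

Lemma not_indep_span T B :
  ~ indep B T ->
  exists2 R, (size R < size T)%N & {in T, forall t, alg (R ++ B) t}.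
Proof.
elim: T B => [|t T IH] B /=; first by case.
have [Bt _|Bt] := pselect (alg B t).
  exists T => // y; rewrite inE => /predU1P[->|Ty].
    by apply: alg_sub Bt => z zB; rewrite mem_cat zB orbT.
  by apply: alg_mem; rewrite mem_cat Ty.
move=> nind; have [|R sR TR] := IH (t :: B).
  by move=> ind; apply: nind.
exists (t :: R) => // y; rewrite inE => /predU1P[->|/TR].
  by apply: alg_mem; rewrite mem_head.
apply: alg_sub => z; rewrite mem_cat inE /= inE mem_cat.
by case/or3P => ->; rewrite ?orbT.
Qed.

(** A dependent [T] would be spanned by fewer elements, against [steinitz]. The independence of
    every new triple of generators comes from this count. *)
Lemma spanning_indep xs T :
  indep [::] xs -> {in xs, forall x, alg T x} -> size T = size xs ->
  indep [::] T.
Proof.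
move=> ind_xs Txs sT; apply: contrapT => /not_indep_span [R sR TR].
have: (size xs <= size R)%N.
  apply: steinitz ind_xs _ => x /Txs; rewrite cats0 => Tx.
  by apply: alg_trans Tx => y /TR; rewrite cats0.
by rewrite leqNgt -sT sR.
Qed.

(** Adds one variable to an injective map out of a ring; iterating it embeds polynomials in several
    variables. *)
Lemma eval_transcendental (R : nzRingType) (f : {rmorphism R -> K}) S t
    (p : {poly R}) :
  (forall r, r != 0 -> f r != 0) -> (forall r, gen S (f r)) -> ~ alg S t ->
  p != 0 -> (map_poly f p).[t] != 0.
Proof.
move=> f0 Sf St p0; apply/eqP => pt; apply: St; apply/algP.
exists (map_poly f p); first by rewrite map_poly_eq0_id0 ?f0 ?lead_coef_eq0.
by split=> [i|]; [rewrite coef_map; apply: Sf|apply/rootP].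
Qed.

Lemma gen_horner (R : nzRingType) (f : {rmorphism R -> K}) S t (p : {poly R}) :
  (forall r, gen S (f r)) -> gen (t :: S) (map_poly f p).[t].
Proof.
move=> Sf; rewrite horner_coef; elim/big_ind: _ => [|x y|i _].
- exact: gen0.
- exact: genD.
apply: genM; last by apply/genX/gen_mem; rewrite mem_head.
by rewrite coef_map; apply: gen_sub (Sf _) => y; rewrite inE orbC => ->.
Qed.

End Steinitz.

(** * Rational function fields *)


Section FractionLift.
Variables (R : idomainType) (K : fieldType) (f : {rmorphism R -> K}).
Hypothesis f_neq0 : forall r, r != 0 -> f r != 0.
Local Notation tofrac := (@FracField.tofrac R).

Lemma fraction_repr (x : {fraction R}) :
  x = tofrac (frac (repr x)).1 / tofrac (frac (repr x)).2.
Proof.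
set n := _.1; set d := _.2.
have d0 : d != 0 := denom_ratioP (repr x).
apply: (@mulIf _ (tofrac d)); first by rewrite tofrac_eq0.
rewrite divfK ?tofrac_eq0 // -[x in LHS]reprK; unlock FracField.tofrac.
rewrite -[LHS]FracField.pi_mul; apply/eqmodP => /=.
rewrite FracField.equivfE /FracField.mulf !numden_Ratio ?(oner_neq0, mulr1) //.
by rewrite mulrC.
Qed.

Lemma fraction_div (x : {fraction R}) :
  exists n d : R, d != 0 /\ x = tofrac n / tofrac d.
Proof.
exists (frac (repr x)).1, (frac (repr x)).2.
by split; [exact: denom_ratioP|exact: fraction_repr].
Qed.

(** Computed on the representative chosen by [repr]; [fraction_lift_div] shows that the choice does
    not matter. *)
Definition fraction_lift (x : {fraction R}) : K :=
  f (frac (repr x)).1 / f (frac (repr x)).2.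

Lemma fraction_lift_div n d : d != 0 ->
  fraction_lift (tofrac n / tofrac d) = f n / f d.
Proof.
move=> d0; rewrite /fraction_lift; set x := tofrac n / tofrac d.
have := fraction_repr x; set m := _.1; set e := _.2 => xE.
have e0 : e != 0 := denom_ratioP (repr x).
apply/eqP; rewrite eqr_div ?f_neq0 // -!rmorphM; apply/eqP; congr (f _).
apply/eqP; rewrite -tofrac_eq !rmorphM /= -eqr_div ?tofrac_eq0 //.
by rewrite -xE.
Qed.

Lemma fraction_lift_img r : fraction_lift (tofrac r) = f r.
Proof.
by rewrite -[tofrac r]divr1 -(rmorph1 tofrac) fraction_lift_div ?oner_neq0 //
  rmorph1 divr1.
Qed.

Fact fraction_lift_zmod : zmod_morphism fraction_lift.
Proof.
move=> x y; have [n [d [d0 ->]]] := fraction_div x.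
have [m [e [e0 ->]]] := fraction_div y.
rewrite -mulNr -rmorphN addf_div ?tofrac_eq0 // -!rmorphM -rmorphD.
rewrite !fraction_lift_div ?mulf_neq0 //.
by rewrite rmorphD !rmorphM rmorphN -addf_div ?f_neq0 // mulNr.
Qed.

Fact fraction_lift_monoid : monoid_morphism fraction_lift.
Proof.
split=> [|x y]; first by rewrite -(rmorph1 tofrac) fraction_lift_img rmorph1.
have [n [d [d0 ->]]] := fraction_div x; have [m [e [e0 ->]]] := fraction_div y.
rewrite mulf_div -!rmorphM !fraction_lift_div ?mulf_neq0 //.
by rewrite mulf_div !rmorphM.
Qed.

HB.instance Definition _ :=
  GRing.isZmodMorphism.Build {fraction R} K fraction_lift fraction_lift_zmod.
HB.instance Definition _ :=
  GRing.isMonoidMorphism.Build {fraction R} K fraction_lift fraction_lift_monoid.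

Lemma fraction_lift_exists :
  exists g : {rmorphism {fraction R} -> K}, forall r, g (tofrac r) = f r.
Proof. by exists fraction_lift => r; exact: fraction_lift_img. Qed.

End FractionLift.

Lemma mem_fst (T : eqType) (x y z : T) : x \in [:: x; y; z].
Proof. by rewrite !inE eqxx. Qed.

Lemma mem_snd (T : eqType) (x y z : T) : y \in [:: x; y; z].
Proof. by rewrite !inE eqxx orbT. Qed.

Lemma mem_thd (T : eqType) (x y z : T) : z \in [:: x; y; z].
Proof. by rewrite !inE eqxx !orbT. Qed.

(** * The field of rational functions in three variables *)

Section RationalFunctions.
Variable k : fieldType.
Local Notation K := (RF3 k).

Definition cst_morphism : {rmorphism k -> K} :=
  @FracField.tofrac _ \o polyC \o polyC \o polyC.
Local Notation gen := (gen cst_morphism).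
Local Notation alg := (alg cst_morphism).
Local Notation indep := (indep cst_morphism).

Lemma gen_poly (R : nzRingType) (f : {rmorphism {poly R} -> K}) S p :
  (forall c, gen S (f c%:P)) -> gen S (f 'X) -> gen S (f p).
Proof.
move=> fC fX; elim/poly_ind: p => [|p c IH]; first by rewrite rmorph0; apply: gen0.
by rewrite rmorphD rmorphM; apply: genD => //; apply: genM.
Qed.



Lemma tofrac_gen (p : {poly {poly {poly k}}}) :
  gen [:: X1 k; X2 k; X3 k] (FracField.tofrac p).
Proof.
apply: (gen_poly (f := @FracField.tofrac _)) => [q|]; last first.
  exact/gen_mem/mem_thd.
apply: (gen_poly (f := @FracField.tofrac _ \o polyC)) => [r|]; last first.
  exact/gen_mem/mem_snd.
apply: (gen_poly (f := @FracField.tofrac _ \o polyC \o polyC)) => [c|].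
  exact: (gen_cst cst_morphism).
exact/gen_mem/mem_fst.
Qed.

Lemma RF3_gen f : gen [:: X1 k; X2 k; X3 k] f.
Proof. by have [n [d [_ ->]]] := fraction_div f; apply: gen_div; apply: tofrac_gen. Qed.

(** The coefficients of a supposed equation for [t] are fractions of values of [f], and clearing
    their denominators leaves a polynomial over [R]. *)
Lemma not_alg_eval (R : nzRingType) (f : {rmorphism R -> K}) S t :
  (forall c, exists r, f r = cst_morphism c) ->
  {in S, forall y, exists r, f r = y} ->
  (forall p : {poly R}, p != 0 -> (map_poly f p).[t] != 0) -> ~ alg S t.
Proof.
move=> fk fS f0 /algP [p p0 [Sp pt]].
have [i|c [q [c0 qE]]] := @clear_denominators _ _ f p.
  apply: gen_frac fk _ (Sp i) => y /fS [r <-]; exact: frac_img.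
have q0 : q != 0.
  apply: contraNneq p0 => q0; move/eqP: qE.
  by rewrite q0 map_poly0 eq_sym scaler_eq0 (negPf c0).
by have := f0 q q0; rewrite qE hornerZ (rootP pt) mulr0 eqxx.
Qed.

Lemma horner_map_polyC (R : nzRingType) (p : {poly R}) :
  (map_poly polyC p).['X] = p.
Proof. exact: comp_polyXr. Qed.

(** Evaluating a polynomial over the preceding ring at the next variable is just embedding that
    polynomial into [RF3 k], hence injective. *)
Lemma X_indep : indep [::] [:: X1 k; X2 k; X3 k].
Proof.
split; [|split; [|split=> //]].
- pose f : {rmorphism {poly k} -> K} := @FracField.tofrac _ \o polyC \o polyC.
  apply: (@not_alg_eval _ cst_morphism) => // [c|p p0]; first by exists c.
  have -> : (map_poly cst_morphism p).[X1 k] = f p.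
    by rewrite -{2}[p]horner_map_polyC -(horner_map f) -map_poly_comp.
  by rewrite tofrac_eq0 !polyC_eq0.
- pose g : {rmorphism {poly k} -> K} := @FracField.tofrac _ \o polyC \o polyC.
  pose f : {rmorphism {poly {poly k}} -> K} := @FracField.tofrac _ \o polyC.
  apply: (@not_alg_eval _ g) => [c|y|p p0]; first by exists c%:P.
    by rewrite inE => /eqP->; exists 'X.
  have -> : (map_poly g p).[X2 k] = f p.
    by rewrite -{2}[p]horner_map_polyC -(horner_map f) -map_poly_comp.
  by rewrite tofrac_eq0 polyC_eq0.
pose g : {rmorphism {poly {poly k}} -> K} := @FracField.tofrac _ \o polyC.
apply: (@not_alg_eval _ g) => [c|y|p p0]; first by exists c%:P%:P.
  by rewrite !inE => /orP[]/eqP->; [exists 'X|exists 'X%:P].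
have -> : (map_poly g p).[X3 k] = FracField.tofrac p.
  by rewrite -{2}[p]horner_map_polyC -(horner_map (@FracField.tofrac _)) -map_poly_comp.
by rewrite tofrac_eq0.
Qed.

(** Evaluation at [T1], [T2], [T3], one variable at a time, is injective by independence, so it
    extends to fractions; its image is the generated subfield. *)
Lemma k_rational_gen (F : K -> Prop) (T1 T2 T3 : K) :
  indep [::] [:: T1; T2; T3] -> (forall f, F f <-> gen [:: T3; T2; T1] f) ->
  k_rational F.
Proof.
move=> [T1_tr [T2_tr [T3_tr _]]] FE.
pose e1 : {rmorphism {poly k} -> K} := horner_eval T1 \o map_poly cst_morphism.
pose e2 : {rmorphism {poly {poly k}} -> K} := horner_eval T2 \o map_poly e1.
pose e3 : {rmorphism {poly {poly {poly k}}} -> K} :=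
  horner_eval T3 \o map_poly e2.
have g0 c : gen [::] (cst_morphism c) by apply: gen_cst.
have g1 p : gen [:: T1] (e1 p) by apply: gen_horner.
have g2 p : gen [:: T2; T1] (e2 p) by apply: gen_horner.
have g3 p : gen [:: T3; T2; T1] (e3 p) by apply: gen_horner.
have n0 c : c != 0 -> cst_morphism c != 0 by rewrite fmorph_eq0.
have n1 p : p != 0 -> e1 p != 0 by apply: eval_transcendental T1_tr.
have n2 p : p != 0 -> e2 p != 0 by apply: eval_transcendental T2_tr.
have n3 p : p != 0 -> e3 p != 0 by apply: eval_transcendental T3_tr.
have [phi phiE] := fraction_lift_exists n3.
have eC (R : nzRingType) (f : {rmorphism R -> K}) t c :
  horner_eval t (map_poly f c%:P) = f c by rewrite /horner_eval map_polyC hornerC.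
have eX (R : nzRingType) (f : {rmorphism R -> K}) t :
  horner_eval t (map_poly f 'X) = t by rewrite /horner_eval map_polyX hornerX.
have phi_cst c : phi (cst c) = cst c.
  by rewrite /cst phiE /e3 /= (eC _ e2) /e2 /= (eC _ e1) /e1 /= (eC _ cst_morphism).
exists phi; split=> // f; rewrite FE; split=> [|[g <-]]; last first.
  by have [n [d [_ ->]]] := fraction_div g; rewrite fmorph_div !phiE; apply: gen_div.
elim=> [c|x|x _ [g <-]|x y _ [g <-] _ [h <-]|x y _ [g <-] _ [h <-]|x _ [g <-]].
- by exists (cst c); rewrite phi_cst.
- rewrite !inE => /or3P[]/eqP->.
  + by exists (X3 k); rewrite /X3 phiE /e3 /= (eX _ e2).
  + by exists (X2 k); rewrite /X2 phiE /e3 /= (eC _ e2) /e2 /= (eX _ e1).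
  by exists (X1 k); rewrite /X1 phiE /e3 /= (eC _ e2) /e2 /= (eC _ e1) /e1 /= (eX _ cst_morphism).
- by exists (- g); rewrite rmorphN.
- by exists (g + h); rewrite rmorphD.
- by exists (g * h); rewrite rmorphM.
by exists g^-1; rewrite fmorphV.
Qed.

End RationalFunctions.

(** * Fixed fields of the Klein group and of a cyclic group of order three *)


Section FixedFields.
Variables (k K : fieldType) (iota : {rmorphism k -> K}).
Local Notation gen := (gen iota).
Local Notation alg := (alg iota).
Local Notation indep := (indep iota).

Lemma alg_poly_rel S (s : seq K) x :
  {in s, forall c, alg S c} -> (Poly s).[x] = 0 -> has (fun c => c != 0) s ->
  alg S x.
Proof.
move=> Ss sx /hasP [c cs c0]; apply: (@alg_root _ _ _ _ (Poly s)).
- apply/eqP => s0; move/negP: c0; apply; apply/eqP.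
  by rewrite -(nth_index 0 cs) -coef_Poly s0 coef0.
- move=> i; rewrite coef_Poly; have [si|si] := leqP (size s) i.
    by rewrite nth_default //; apply/alg_gen/gen0.
  exact/Ss/mem_nth.
- exact/rootP.
Qed.

Lemma alg_linear S a b x :
  alg S a -> alg S b -> a * x + b = 0 -> a != 0 \/ b != 0 -> alg S x.
Proof.
move=> Sa Sb E ab0; apply: (@alg_poly_rel S [:: b; a]).
- by move=> c; rewrite !inE => /orP[]/eqP->.
- by rewrite -E /= !horner_cons hornerC; ring.
by rewrite /= orbF orbC; case: ab0 => ->; rewrite ?orbT.
Qed.

Lemma alg_quadratic S a b c x :
  alg S a -> alg S b -> alg S c -> a * x ^+ 2 + b * x + c = 0 ->
  [\/ a != 0, b != 0 | c != 0] -> alg S x.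
Proof.
move=> Sa Sb Sc E abc0; apply: (@alg_poly_rel S [:: c; b; a]).
- by move=> d; rewrite !inE => /or3P[]/eqP->.
- by rewrite -E /= !horner_cons hornerC; ring.
by rewrite /= orbF; case: abc0 => ->; rewrite ?orbT.
Qed.

Lemma alg_sqrt S x : alg S (x ^+ 2) -> alg S x.
Proof.
move=> Sx; apply: (@alg_quadratic S 1 0 (- x ^+ 2)).
- exact/alg_gen/gen1.
- exact/alg_gen/gen0.
- exact: algN.
- by rewrite mul1r mul0r addr0 subrr.
- by constructor 1; apply: oner_neq0.
Qed.

Lemma gen_fixed (s : {rmorphism K -> K}) S x :
  (forall c, s (iota c) = iota c) -> {in S, forall y, s y = y} ->
  gen S x -> s x = x.
Proof.
move=> sk sS; elim=> [c|y /sS|y _ E|y z _ Ey _ Ez|y z _ Ey _ Ez|y _ E] //.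
- by rewrite rmorphN E.
- by rewrite rmorphD Ey Ez.
- by rewrite rmorphM Ey Ez.
- by rewrite fmorphV E.
Qed.

(** * Fixed field of a Klein group acting by signs *)

Section Biquadratic.
Variables (T : seq K) (tau lam : {rmorphism K -> K}) (p1 p2 : K).
Hypothesis two_neq0 : 2%:R != 0 :> K.
Hypotheses (tauT : forall x, gen T x -> tau x = x)
           (lamT : forall x, gen T x -> lam x = x).
Hypotheses (tau_p1 : tau p1 = - p1) (lam_p1 : lam p1 = - p1)
           (tau_p2 : tau p2 = - p2) (lam_p2 : lam p2 = p2).
Hypotheses (p1_sqr : gen T (p1 ^+ 2)) (p2_sqr : gen T (p2 ^+ 2)).

(** The monomials [1], [p1], [p2], [p1 * p2] carry the four sign characters of [tau] and [lam]. *)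
Let biq (m0 m1 m2 m3 : K) := m0 + m1 * p1 + m2 * p2 + m3 * (p1 * p2).
Let isbiq f := exists m0 m1 m2 m3,
  [/\ gen T m0, gen T m1, gen T m2, gen T m3 & f = biq m0 m1 m2 m3].

Let isbiq_gen m : gen T m -> isbiq m.
Proof.
move=> Tm; exists m, 0, 0, 0; split=> //; try exact: gen0.
by rewrite /biq !mul0r !addr0.
Qed.

Let isbiqN f : isbiq f -> isbiq (- f).
Proof.
case=> a [b [c [d [? ? ? ? ->]]]]; exists (- a), (- b), (- c), (- d).
by split; try exact: genN; rewrite /biq; ring.
Qed.

Let isbiqD f g : isbiq f -> isbiq g -> isbiq (f + g).
Proof.
case=> a [b [c [d [? ? ? ? ->]]]] [a' [b' [c' [d' [? ? ? ? ->]]]]].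
exists (a + a'), (b + b'), (c + c'), (d + d').
by split; try exact: genD; rewrite /biq; ring.
Qed.

Let isbiqM f g : isbiq f -> isbiq g -> isbiq (f * g).
Proof.
case=> a [b [c [d [? ? ? ? ->]]]] [a' [b' [c' [d' [? ? ? ? ->]]]]].
exists (a * a' + b * b' * p1 ^+ 2 + c * c' * p2 ^+ 2
          + d * d' * (p1 ^+ 2 * p2 ^+ 2)),
  (a * b' + b * a' + (c * d' + d * c') * p2 ^+ 2),
  (a * c' + c * a' + (b * d' + d * b') * p1 ^+ 2),
  (a * d' + d * a' + b * c' + c * b').
by split; gen_tac; rewrite /biq; ring.
Qed.

Let tau_biq a b c d : gen T a -> gen T b -> gen T c -> gen T d ->
  tau (biq a b c d) = biq a (- b) (- c) d.
Proof.
move=> Ta Tb Tc Td; rewrite /biq !(rmorphD, rmorphM) /= tau_p1 tau_p2.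
by rewrite !tauT //; ring.
Qed.

Let lam_biq a b c d : gen T a -> gen T b -> gen T c -> gen T d ->
  lam (biq a b c d) = biq a (- b) c (- d).
Proof.
move=> Ta Tb Tc Td; rewrite /biq !(rmorphD, rmorphM) /= lam_p1 lam_p2.
by rewrite !lamT //; ring.
Qed.

Let isbiq_tau f : isbiq f -> isbiq (tau f).
Proof.
case=> a [b [c [d [Ta Tb Tc Td ->]]]]; rewrite tau_biq //.
by exists a, (- b), (- c), d; split=> //; apply: genN.
Qed.

Let isbiq_lam f : isbiq f -> isbiq (lam f).
Proof.
case=> a [b [c [d [Ta Tb Tc Td ->]]]]; rewrite lam_biq //.
by exists a, (- b), c, (- d); split=> //; apply: genN.
Qed.

Let tau_tau f : isbiq f -> tau (tau f) = f.
Proof.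
case=> a [b [c [d [Ta Tb Tc Td ->]]]].
by rewrite !tau_biq //; do ?apply: genN => //; rewrite !opprK.
Qed.

Let lam_lam f : isbiq f -> lam (lam f) = f.
Proof.
case=> a [b [c [d [Ta Tb Tc Td ->]]]].
by rewrite !lam_biq //; do ?apply: genN => //; rewrite !opprK.
Qed.

Let lam_tau f : isbiq f -> lam (tau f) = tau (lam f).
Proof.
case=> a [b [c [d [Ta Tb Tc Td ->]]]].
by rewrite tau_biq // lam_biq // ?lam_biq // ?tau_biq //; do ?apply: genN.
Qed.

(** The differences between [f] and its conjugates are twice the sums of two of the three
    nonconstant terms. These sums therefore vanish, and together they make up twice the nonconstant
    part. *)
Let fixed_biq f : isbiq f -> tau f = f -> lam f = f -> gen T f.
Proof.
case=> a [b [c [d [Ta Tb Tc Td fE]]]].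
rewrite fE => taufE; rewrite lam_biq // => lamfE; move: taufE (taufE).
rewrite {1}tau_biq // => taufE tauE.
have tlE : biq a b (- c) (- d) = biq a b c d.
  by rewrite -[RHS]tauE -lamfE tau_biq ?opprK //; apply: genN.
have E1 : b * p1 + c * p2 = 0.
  apply: (mulfI two_neq0); rewrite mulr0 -(subrr (biq a b c d)) -{2}taufE.
  by rewrite /biq; ring.
have E2 : b * p1 + d * (p1 * p2) = 0.
  apply: (mulfI two_neq0); rewrite mulr0 -(subrr (biq a b c d)) -{2}lamfE.
  by rewrite /biq; ring.
have E3 : c * p2 + d * (p1 * p2) = 0.
  apply: (mulfI two_neq0); rewrite mulr0 -(subrr (biq a b c d)) -{2}tlE.
  by rewrite /biq; ring.
suff -> : biq a b c d = a by [].
apply: (mulfI two_neq0); rewrite /biq.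
have -> : 2%:R * (a + b * p1 + c * p2 + d * (p1 * p2)) = 2%:R * a
  + (b * p1 + c * p2) + (b * p1 + d * (p1 * p2)) + (c * p2 + d * (p1 * p2)).
  by ring.
by rewrite E1 E2 E3 !addr0.
Qed.

(** Write [f = n / d] with [n] and [d] of the form [biq]. Multiplying both by the other three
    conjugates of [d] makes the denominator a norm; then numerator and denominator are fixed
    separately. *)
Lemma fixed_biquadratic f :
  gen [:: p1, p2 & T] f -> tau f = f -> lam f = f -> gen T f.
Proof.
move=> Gf.
have [n [d [bn bd d0 ->]]] :
    exists n d, [/\ isbiq n, isbiq d, d != 0 & f = n / d].
  have b1 : isbiq 1 by apply/isbiq_gen/gen1.
  have one0 := oner_neq0 K.
  have img x : isbiq x -> exists n d, [/\ isbiq n, isbiq d, d != 0 & x = n / d].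
    by exists x, 1; split; rewrite ?divr1.
  elim: Gf => [c|y|y _|y z _ + _|y z _ + _|y _].
  - exact/img/isbiq_gen/gen_cst.
  - rewrite !inE => /or3P[/eqP->|/eqP->|Ty]; apply: img.
    + exists 0, 1, 0, 0; split; try exact: gen0; try exact: gen1.
      by rewrite /biq; ring.
    + exists 0, 0, 1, 0; split; try exact: gen0; try exact: gen1.
      by rewrite /biq; ring.
    by apply/isbiq_gen/gen_mem.
  - by case=> n [d [bn bd d0 ->]]; exists (- n), d; split; rewrite ?mulNr //; auto.
  - case=> n [d [bn bd d0 ->]] [m [e [bm be e0 ->]]].
    exists (n * e + m * d), (d * e).
    by split; rewrite ?mulf_neq0 ?addf_div //; auto.
  - case=> n [d [bn bd d0 ->]] [m [e [bm be e0 ->]]].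
    by exists (n * m), (d * e); split; rewrite ?mulf_neq0 ?mulf_div //; auto.
  case=> n [d [bn bd d0 ->]]; have [->|n0] := eqVneq n 0.
    by rewrite mul0r invr0; apply/img/isbiq_gen/gen0.
  by exists d, n; split; rewrite ?invf_div.
set g := n / d => tg lg.
pose N := d * tau d * (lam d * tau (lam d)).
have N0 : N != 0 by rewrite !mulf_neq0 ?fmorph_eq0.
have bld := isbiq_lam bd; have btd := isbiq_tau bd.
have btld := isbiq_tau bld.
have bN : isbiq N by do !apply: isbiqM.
have tN : tau N = N.
  by rewrite /N !rmorphM (tau_tau bd) (tau_tau bld); ring.
have lN : lam N = N.
  by rewrite /N !rmorphM (lam_lam bd) (lam_tau bd) (lam_tau bld) (lam_lam bd); ring.
have bgN : isbiq (g * N).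
  have -> : g * N = n * (tau d * (lam d * tau (lam d))).
    by rewrite /g /N -!mulrA mulKf.
  by do !apply: isbiqM.
rewrite -[g](mulfK N0); apply: gen_div; last exact: fixed_biq.
by apply: fixed_biq; rewrite // rmorphM ?tg ?tN ?lg ?lN.
Qed.

End Biquadratic.

End FixedFields.


(** * Fixed field of a cyclic group of order three *)

Section CyclicCubic.
Variables (k K : fieldType) (iota : {rmorphism k -> K}).
Local Notation gen := (gen iota).
Local Notation alg := (alg iota).

Variables (T : seq K) (sig : {rmorphism K -> K}) (y1 y2 y3 : K).
Hypothesis two_neq0 : 2%:R != 0 :> K.
Hypothesis sigT : forall x, gen T x -> sig x = x.
Hypotheses (sig1 : sig y1 = y2) (sig2 : sig y2 = y3) (sig3 : sig y3 = y1).
Hypothesis y12 : y1 != y2.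
Hypotheses (e1_gen : gen T (y1 + y2 + y3))
  (e2_gen : gen T (y1 * y2 + y2 * y3 + y3 * y1)) (e3_gen : gen T (y1 * y2 * y3)).
Hypothesis disc_gen : gen T ((y1 - y2) * (y2 - y3) * (y3 - y1)).

Let e1 := y1 + y2 + y3.
Let e2 := y1 * y2 + y2 * y3 + y3 * y1.
Let e3 := y1 * y2 * y3.

Let quad (m0 m1 m2 y : K) := m0 + m1 * y + m2 * y ^+ 2.
Let isquad f := exists m0 m1 m2,
  [/\ gen T m0, gen T m1, gen T m2 & f = quad m0 m1 m2 y1].

Let isquad_gen m : gen T m -> isquad m.
Proof. by move=> Tm; exists m, 0, 0; split; gen_tac; rewrite /quad; ring. Qed.

Let isquadN f : isquad f -> isquad (- f).
Proof.
case=> a [b [c [? ? ? ->]]]; exists (- a), (- b), (- c).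
by split; gen_tac; rewrite /quad; ring.
Qed.

Let isquadD f g : isquad f -> isquad g -> isquad (f + g).
Proof.
case=> a [b [c [? ? ? ->]]] [a' [b' [c' [? ? ? ->]]]].
exists (a + a'), (b + b'), (c + c').
by split; gen_tac; rewrite /quad; ring.
Qed.

Let isquadM f g : isquad f -> isquad g -> isquad (f * g).
Proof.
case=> a [b [c [? ? ? ->]]] [a' [b' [c' [? ? ? ->]]]].
(* [q] and [r] are the coefficients of [y1 ^+ 3] and [y1 ^+ 4] in the product, which are reduced by
   the cubic with roots [y1], [y2], [y3]. *)
pose q := b * c' + c * b'; pose r := c * c'.
exists (a * a' + q * e3 + r * (e1 * e3)),
  (a * b' + b * a' - q * e2 + r * (e3 - e1 * e2)),
  (a * c' + b * b' + c * a' + q * e1 + r * (e1 ^+ 2 - e2)).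
by split; rewrite /q /r; gen_tac; rewrite /quad /e1 /e2 /e3; ring.
Qed.

Let isquad_y1 : isquad y1.
Proof. by exists 0, 1, 0; split; gen_tac; rewrite /quad; ring. Qed.

Let y23 : y2 != y3.
Proof.
by apply: contraNneq y12 => E; apply/eqP/(fmorph_inj sig); rewrite sig1 sig2.
Qed.

Let y31 : y3 != y1.
Proof.
by apply: contraNneq y23 => E; apply/eqP/(fmorph_inj sig); rewrite sig2 sig3.
Qed.

(** A fixed [f], as a polynomial of degree at most two in [y1], takes the same value at the three
    distinct conjugates. Its divided differences vanish, so it is constant. *)
Let fixed_quad f : isquad f -> sig f = f -> gen T f.
Proof.
case=> a [b [c [Ta Tb Tc fE]]] sf.
have sq y : sig (quad a b c y) = quad a b c (sig y).
  by rewrite /quad !(rmorphD, rmorphM, rmorphXn) /= (sigT Ta) (sigT Tb) (sigT Tc).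
have f2 : quad a b c y2 = f by rewrite -sig1 -sq -fE sf.
have f3 : quad a b c y3 = f by rewrite -sig2 -sq f2 sf.
have d12 : b + c * (y1 + y2) = 0.
  have y12' : y1 - y2 != 0 by rewrite subr_eq0.
  apply: (mulfI y12'); rewrite mulr0 -(subrr f) {1}fE -f2.
  by rewrite /quad; ring.
have d23 : b + c * (y2 + y3) = 0.
  have y23' : y2 - y3 != 0 by rewrite subr_eq0.
  apply: (mulfI y23'); rewrite mulr0 -(subrr f) -{1}f2 -f3.
  by rewrite /quad; ring.
have c0 : c = 0.
  have y31' : y3 - y1 != 0 by rewrite subr_eq0.
  apply: (mulfI y31'); rewrite mulr0 -(subrr 0) -{1}d23 -d12.
  by ring.
have b0 : b = 0 by move: d12; rewrite c0 mul0r addr0.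
by rewrite fE /quad b0 c0 !mul0r !addr0.
Qed.

(* The other two conjugates are the roots of a quadratic over the field
   generated by y1, so the cofactor of the norm lies in that field. *)
Let isquadV f : isquad f -> isquad f^-1.
Proof.
move=> qf; have [->|f0] := eqVneq f 0.
  by rewrite invr0; apply/isquad_gen/gen0.
have [a [b [c [Ta Tb Tc fE]]]] := qf.
have sq y : sig (quad a b c y) = quad a b c (sig y).
  by rewrite /quad !(rmorphD, rmorphM, rmorphXn) /= (sigT Ta) (sigT Tb) (sigT Tc).
pose g := sig f; pose h := sig g.
have gE : g = quad a b c y2 by rewrite /g fE sq sig1.
have hE : h = quad a b c y3 by rewrite /h gE sq sig2.
have g0 : g != 0 by rewrite fmorph_eq0.
have h0 : h != 0 by rewrite fmorph_eq0.
(* These are [y2 + y3] and [y2 * y3]. *)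
pose s := e1 - y1; pose p := e2 - y1 * s.
have qs : isquad s by apply: isquadD; [apply: isquad_gen|apply: isquadN].
have qp : isquad p.
  by apply: isquadD; [apply: isquad_gen|apply/isquadN/isquadM].
have qgh : isquad (g * h).
  have -> : g * h = a * a + a * b * s + a * c * (s * s - (p + p)) + b * b * p
                    + b * c * (p * s) + c * c * (p * p).
    by rewrite gE hE /quad /p /s /e1 /e2; ring.
  have Q x y : gen T x -> gen T y -> isquad (x * y).
    by move=> Tx Ty; apply: isquad_gen; gen_tac.
  do ?apply: isquadD; do ?[exact: Q | apply: isquadM; [exact: Q|]] => //.
  - by apply: isquadD; [apply: isquadM|apply/isquadN/isquadD].
  - exact: isquadM.
  - exact: isquadM.
have TN : gen T (f * (g * h)).
  apply: fixed_quad; first exact: isquadM.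
  rewrite !rmorphM -/g -/h {2}hE sq sig3 -fE.
  by ring.
have -> : f^-1 = (f * (g * h))^-1 * (g * h).
  by rewrite invfM -mulrA mulVf ?mulr1 // mulf_neq0.
by apply: isquadM => //; apply/isquad_gen/genV.
Qed.

(** The element [y1] alone generates the field over [gen T]: [y2 + y3] is [e1 - y1], and [y2 - y3]
    is the square root of the discriminant divided by [N]. Then [fixed_quad] applies. *)
Lemma fixed_cyclic_cubic f : gen [:: y1; y2; y3] f -> sig f = f -> gen T f.
Proof.
move=> Gf; apply: fixed_quad.
(* Up to sign the derivative of the cubic at [y1], hence quadratic in [y1]. *)
pose N := (y1 - y2) * (y3 - y1).
have qN : isquad N.
  have -> : N = (e1 + e1) * y1 - (y1 * y1 + y1 * y1 + y1 * y1) - e2.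
    by rewrite /N /e1 /e2; ring.
  apply: isquadD; last exact/isquadN/isquad_gen.
  apply: isquadD; first by apply: isquadM => //; apply: isquad_gen; gen_tac.
  by apply: isquadN; do !apply: isquadD; apply: isquadM.
have N0 : N != 0 by rewrite mulf_neq0 ?subr_eq0.
have q23 : isquad (y2 - y3).
  have -> : y2 - y3 = (y1 - y2) * (y2 - y3) * (y3 - y1) * N^-1.
    by apply: (mulIf N0); rewrite divfK // /N; ring.
  by apply: isquadM; [apply: isquad_gen|apply: isquadV].
have q_half : isquad 2%:R^-1 by apply: isquad_gen; gen_tac.
have q2 : isquad y2.
  have -> : y2 = 2%:R^-1 * (e1 - y1 + (y2 - y3)).
    by apply: (mulfI two_neq0); rewrite mulVKf // /e1; ring.
  apply: isquadM => //; apply: isquadD => //.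
  by apply: isquadD; [apply: isquad_gen|apply: isquadN].
have q3 : isquad y3.
  have -> : y3 = e1 - y1 - y2 by rewrite /e1; ring.
  apply: isquadD; last exact: isquadN.
  by apply: isquadD; [apply: isquad_gen|apply: isquadN].
elim: Gf => [c|y|y _|y z _ qy _ qz|y z _ qy _ qz|y _] //.
- exact/isquad_gen/gen_cst.
- by rewrite !inE => /or3P[]/eqP->.
- exact: isquadN.
- exact: isquadD.
- exact: isquadM.
- exact: isquadV.
Qed.

End CyclicCubic.


(** * Masuda's generators of the cyclic invariants *)

Section Masuda.
Variables (K : fieldType) (y1 y2 y3 : K).
Let e1 := y1 + y2 + y3.
Let e2 := y1 * y2 + y2 * y3 + y3 * y1.
Let e3 := y1 * y2 * y3.

(** The product of the Lagrange resolvents [y1 + w y2 + w^2 y3] and [y1 + w^2 y2 + w y3], where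
    [w^2 + w + 1 = 0]. *)
Definition masuda_den := e1 ^+ 2 - 3%:R * e2.
Definition masuda_u :=
  (y1 * y2 ^+ 2 + y2 * y3 ^+ 2 + y3 * y1 ^+ 2 - 3%:R * e3) / masuda_den.
Definition masuda_v :=
  (y1 ^+ 2 * y2 + y2 ^+ 2 * y3 + y3 ^+ 2 * y1 - 3%:R * e3) / masuda_den.
Local Notation u := masuda_u.
Local Notation v := masuda_v.

Hypothesis den_neq0 : masuda_den != 0.

(** Together with [masuda_e3] and [masuda_disc], this puts into the field generated by [e1], [u],
    [v] all that [fixed_cyclic_cubic] asks for. *)
Lemma masuda_e2 : e2 = e1 * (u + v) - 3%:R * (u ^+ 2 - u * v + v ^+ 2).
Proof.
move: den_neq0; rewrite /u /v /masuda_den /e1 /e2 /e3 => ?; field.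
by [].
Qed.

Lemma masuda_e3 : e3 = e1 * u * v - (u ^+ 3 + v ^+ 3).
Proof.
move: den_neq0; rewrite /u /v /masuda_den /e1 /e2 /e3 => ?; field.
by [].
Qed.

Lemma masuda_disc : (y1 - y2) * (y2 - y3) * (y3 - y1) = (u - v) * masuda_den.
Proof. by rewrite /u /v [RHS]mulrBl !divfK // /e3; ring. Qed.

End Masuda.

(** * From the Klein invariants to the full fixed field *)

Section CyclicDescent.
Variables (k K : fieldType) (iota : {rmorphism k -> K}).
Hypothesis two_neq0 : 2%:R != 0 :> K.
Local Notation gen := (gen iota).
Local Notation alg := (alg iota).
Local Notation indep := (indep iota).

(** Once [y1], [y2], [y3] generate the fixed field of [tau] and [lam], Masuda's elements generate
    the [sig]-invariants in it. Everything in [xs] is algebraic over the [y]'s, and these over [e1],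
    [u], [v], so a count gives the independence of both triples. *)
Lemma cyclic_descent (tau lam sig : {rmorphism K -> K}) (xs : seq K)
    (y1 y2 y3 : K) :
  indep [::] xs -> size xs = 3%N ->
  (forall c, tau (iota c) = iota c) -> (forall c, lam (iota c) = iota c) ->
  (forall c, sig (iota c) = iota c) ->
  sig y1 = y2 -> sig y2 = y3 -> sig y3 = y1 ->
  {in [:: y1; y2; y3], forall y, tau y = y} ->
  {in [:: y1; y2; y3], forall y, lam y = y} ->
  {in xs, forall x, alg [:: y1; y2; y3] x} ->
  (forall f, tau f = f -> lam f = f -> gen [:: y1; y2; y3] f) ->
  exists T1 T2 T3, indep [::] [:: T1; T2; T3] /\
    forall f, tau f = f /\ lam f = f /\ sig f = f <-> gen [:: T3; T2; T1] f.
Proof.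
move=> xs_indep xs3 tauk lamk sigk sig1 sig2 sig3 tau_y lam_y alg_x fixed_gen.
have [y1_tr [y2_tr [y3_tr _]]] : indep [::] [:: y1; y2; y3].
  exact: spanning_indep xs_indep alg_x _.
have den0 : masuda_den y1 y2 y3 != 0.
  apply/eqP => E; apply: y3_tr.
  have a1 : alg [:: y2; y1] y1 by apply: alg_mem; rewrite !inE eqxx orbT.
  have a2 : alg [:: y2; y1] y2 by apply: alg_mem; rewrite !inE eqxx.
  (* A vanishing [masuda_den] is a monic quadratic equation for [y3] over [y1] and [y2]. *)
  apply: (@alg_quadratic _ _ _ _ 1 (- (y1 + y2)) (y1 ^+ 2 - y1 * y2 + y2 ^+ 2));
    try by alg_tac.
  - by rewrite -[RHS]E /masuda_den; ring.
  - by constructor 1; apply: oner_neq0.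
have y12 : y1 != y2.
  by apply/eqP => E; apply: y2_tr; rewrite -E; apply: alg_mem; rewrite mem_head.
pose e1 := y1 + y2 + y3; pose u := masuda_u y1 y2 y3; pose v := masuda_v y1 y2 y3.
pose T := [:: e1; u; v].
have Te1 : gen T e1 by exact/gen_mem/mem_fst.
have Tu : gen T u by exact/gen_mem/mem_snd.
have Tv : gen T v by exact/gen_mem/mem_thd.
have Te2 : gen T (y1 * y2 + y2 * y3 + y3 * y1).
  by rewrite masuda_e2 // -/u -/v -/e1; gen_tac.
have Te3 : gen T (y1 * y2 * y3) by rewrite masuda_e3 // -/u -/v -/e1; gen_tac.
have Td : gen T ((y1 - y2) * (y2 - y3) * (y3 - y1)).
  rewrite masuda_disc // -/u -/v; apply: genM; first by gen_tac.
  by rewrite /masuda_den; gen_tac.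
have Y1 : y1 \in [:: y1; y2; y3] by exact: mem_fst.
have Y2 : y2 \in [:: y1; y2; y3] by exact: mem_snd.
have Y3 : y3 \in [:: y1; y2; y3] by exact: mem_thd.
have sigT x : gen T x -> sig x = x.
  apply: (gen_fixed sigk) => {}x.
  have sig_den : sig (masuda_den y1 y2 y3) = masuda_den y1 y2 y3.
    rewrite /masuda_den !(rmorphB, rmorphD, rmorphM, rmorphXn, rmorph_nat) /=.
    by rewrite sig1 sig2 sig3; ring.
  rewrite !inE => /or3P[]/eqP->.
  - by rewrite /e1 !rmorphD /= sig1 sig2 sig3; ring.
  - rewrite /u /masuda_u fmorph_div sig_den; congr (_ / _).
    rewrite !(rmorphB, rmorphD, rmorphM, rmorphXn, rmorph_nat) /=.
    by rewrite sig1 sig2 sig3; ring.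
  rewrite /v /masuda_v fmorph_div sig_den; congr (_ / _).
  rewrite !(rmorphB, rmorphD, rmorphM, rmorphXn, rmorph_nat) /=.
  by rewrite sig1 sig2 sig3; ring.
have gy x : gen T x -> gen [:: y1; y2; y3] x.
  have g1 : gen [:: y1; y2; y3] y1 by apply: gen_mem.
  have g2 : gen [:: y1; y2; y3] y2 by apply: gen_mem.
  have g3 : gen [:: y1; y2; y3] y3 by apply: gen_mem.
  apply: gen_trans => {}x; rewrite !inE => /or3P[]/eqP->.
  - by rewrite /e1; gen_tac.
  - by rewrite /u /masuda_u /masuda_den; gen_tac.
  - by rewrite /v /masuda_v /masuda_den; gen_tac.
have alg_y y : y \in [:: y1; y2; y3] -> alg T y.
  move=> Yy; apply: (@alg_poly_rel _ _ _ _ [:: - (y1 * y2 * y3);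
     y1 * y2 + y2 * y3 + y3 * y1; - e1; 1]).
  - move=> c; rewrite !inE => /or4P[]/eqP->; apply: alg_gen => //;
      try exact: genN; exact: gen1.
  - rewrite /= !horner_cons hornerC.
    by move: Yy; rewrite !inE /e1 => /or3P[]/eqP->; ring.
  - by rewrite /= oner_neq0 !orbT.
have T_indep : indep [::] [:: v; u; e1].
  apply: spanning_indep xs_indep _ _ => // x /alg_x; apply: alg_trans => y.
  move/alg_y; apply: alg_sub => z; rewrite !inE.
  by case/or3P=> ->; rewrite ?orbT.
exists v, u, e1; split=> // f; split=> [[tf [lf sf]]|Tf].
  apply: (@fixed_cyclic_cubic _ _ _ T sig y1 y2 y3) => //.
  exact: fixed_gen.
split; [|split].
- by apply: (gen_fixed tauk tau_y); apply: gy.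
- by apply: (gen_fixed lamk lam_y); apply: gy.
exact: sigT.
Qed.

End CyclicDescent.

(** * The case epsilon = 1 *)


Section SplitCase.
Variables (K : fieldType) (A : K).

(** For [s^2 = A], let X, Y, Z be the values of [(t - s)/(t + s)] at [x], [y], [z]. Then
    [split_inv A x y z] is the [t] whose value is YZ/X. Changing [s] to [-s] inverts all these
    values, so the formula is free of [s]. *)
Definition split_den (x y z : K) := x * y + x * z - y * z - A.
Definition split_inv (x y z : K) :=
  (x * y * z + A * (x - y - z)) / split_den x y z.

Lemma split_invC x y z : split_inv x z y = split_inv x y z.
Proof. by rewrite /split_inv /split_den; congr (_ / _); ring. Qed.

Lemma split_inv12 x y z : A != 0 -> x != 0 -> y != 0 -> split_den x y z != 0 ->
  split_inv (A / x) (A / y) z = split_inv x y z.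
Proof.
move=> A0 x0 y0 d0; rewrite /split_inv.
have -> : split_den (A / x) (A / y) z = - (A / (x * y)) * split_den x y z.
  by rewrite /split_den; field; rewrite x0 y0.
have -> : A / x * (A / y) * z + A * (A / x - A / y - z)
    = - (A / (x * y)) * (x * y * z + A * (x - y - z)).
  by field; rewrite x0 y0.
by rewrite -mulf_div divff ?mul1r // oppr_eq0 mulf_neq0 ?invr_eq0 ?mulf_neq0.
Qed.

Lemma split_inv23 x y z : A != 0 -> y != 0 -> z != 0 -> split_den x y z != 0 ->
  split_inv x (A / y) (A / z) = split_inv x y z.
Proof.
move=> A0 y0 z0 d0; rewrite /split_inv.
have -> : split_den x (A / y) (A / z) = A / (y * z) * split_den x y z.
  by rewrite /split_den; field; rewrite y0 z0.
have -> : x * (A / y) * (A / z) + A * (x - A / y - A / z)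
    = A / (y * z) * (x * y * z + A * (x - y - z)).
  by field; rewrite y0 z0.
by rewrite -mulf_div divff ?mul1r // mulf_neq0 ?invr_eq0 ?mulf_neq0.
Qed.

Lemma split_inv13 x y z : A != 0 -> x != 0 -> z != 0 -> split_den x y z != 0 ->
  split_inv (A / x) y (A / z) = split_inv x y z.
Proof.
move=> A0 x0 z0 d0; have dC : split_den x z y = split_den x y z by rewrite /split_den; ring.
rewrite -[LHS]split_invC -[RHS]split_invC.
by apply: split_inv12 => //; rewrite dC.
Qed.

(* (t - s)/(t + s) for s^2 = A turns t |-> A/t into a change of sign, and the
   invariants split_inv are then yz/x, zx/y, xy/z; the product of the last two
   is the square of x. *)
Lemma split_inv_sum x y z :
  split_den y z x != 0 -> split_den z x y != 0 ->
  (split_inv y z x + split_inv z x y) * (x ^+ 2 + A)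
  = 2%:R * x * (split_inv y z x * split_inv z x y + A).
Proof.
by rewrite /split_inv /split_den => d1 d2; field; rewrite d1 d2.
Qed.

End SplitCase.

Section Independence.
Variables (k K : fieldType) (iota : {rmorphism k -> K}).
Local Notation alg := (alg iota).
Local Notation indep := (indep iota).

(** [indep] reads its list in order, but counting by [spanning_indep] is insensitive to order. *)
Lemma indep_perm xs ys : perm_eq xs ys -> indep [::] xs -> indep [::] ys.
Proof.
move=> xy xs_indep; apply: spanning_indep xs_indep _ _.
  by move=> x xs_x; apply: alg_mem; rewrite -(perm_mem xy).
by apply/esym/perm_size.
Qed.

Lemma indep_not_alg x y z : indep [::] [:: x; y; z] ->
  [/\ ~ alg [:: y; z] x, ~ alg [:: z; x] y & ~ alg [:: x; y] z].
Proof.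
move=> xyz; split.
- have [|_ [_ [//]]] := @indep_perm _ [:: z; y; x] _ xyz.
  by rewrite -[[:: z; y; x]]/(rev [:: x; y; z]) perm_sym perm_rev.
- have [|_ [_ [//]]] := @indep_perm _ [:: x; z; y] _ xyz.
  by rewrite perm_cons -[[:: z; y]]/(rev [:: y; z]) perm_sym perm_rev.
case: xyz => _ [_ [xyz _]] E; apply: xyz; apply: alg_sub E => t.
by rewrite !inE orbC.
Qed.

End Independence.

(** * The fixed field for epsilon = 1 *)

Section SplitFixedField.
Variables (k K : fieldType) (iota : {rmorphism k -> K}).
Hypothesis two_neq0 : 2%:R != 0 :> K.
Local Notation gen := (gen iota).
Local Notation alg := (alg iota).
Local Notation indep := (indep iota).
Variables (a : k) (tau lam sig : {rmorphism K -> K}).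
Hypothesis a_neq0 : a != 0.
Let A := iota a.

Let A_neq0 : A != 0. Proof. by rewrite fmorph_eq0. Qed.

Let den_neq0 x y z : indep [::] [:: x; y; z] -> split_den A x y z != 0.
Proof.
move=> /indep_not_alg [x_tr y_tr _]; apply/eqP => E; apply: x_tr.
have y_alg : alg [:: y; z] y by apply: alg_mem; rewrite !inE eqxx.
have z_alg : alg [:: y; z] z by apply: alg_mem; rewrite !inE eqxx orbT.
have A_alg : alg [:: y; z] A by apply: alg_cst.
apply: (@alg_linear _ _ _ _ (y + z) (- (y * z + A))); try by alg_tac.
  by rewrite -[RHS]E /split_den; ring.
left; apply/eqP => yz; apply: y_tr.
have -> : y = - z by apply/eqP; rewrite -addr_eq0 yz.
by apply/algN/alg_mem; rewrite mem_head.
Qed.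

(** The coefficient of [z] in the equation saying that [split_inv A x y z] has value [s]. It is
    linear in [x], and its leading coefficient [y - s] is nonzero because [s] is algebraic over
    [k]. *)
Let coef_neq0 x y z s : indep [::] [:: x; y; z] -> alg [::] s ->
  x * y - A - s * (x - y) != 0.
Proof.
move=> xyz s_alg; have [x_tr y_tr _] := indep_not_alg xyz.
apply/eqP => E; apply: x_tr.
have y_alg : alg [:: y; z] y by apply: alg_mem; rewrite !inE eqxx.
have A_alg : alg [:: y; z] A by apply: alg_cst.
have s_alg' : alg [:: y; z] s by apply: alg_sub s_alg.
apply: (@alg_linear _ _ _ _ (y - s) (s * y - A)); try by alg_tac.
  by rewrite -[RHS]E; ring.
left; rewrite subr_eq0; apply/eqP => ys; apply: y_tr; rewrite ys.
exact: alg_sub s_alg.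
Qed.

(** If the sum vanished, [split_inv_sum] would force the square of each summand to be [A]. The
    summand would be algebraic over [k], and its defining equation, solved for [x], would make [x]
    algebraic over [y] and [z]. *)
Let sum_neq0 x y z : indep [::] [:: x; y; z] ->
  split_inv A y z x + split_inv A z x y != 0.
Proof.
move=> xyz.
have yzx : indep [::] [:: y; z; x].
  by apply: indep_perm xyz; rewrite perm_sym (perm_rot 1 [:: x; y; z]).
have zxy : indep [::] [:: z; x; y].
  by apply: indep_perm xyz; rewrite perm_sym (perm_rot 2 [:: x; y; z]).
have [x_tr y_tr _] := indep_not_alg xyz.
have x0 : x != 0.
  by apply/eqP => x0; apply: x_tr; rewrite x0; apply/alg_gen/gen0.
apply/eqP => S0; have := split_inv_sum (den_neq0 yzx) (den_neq0 zxy).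
rewrite S0 mul0r => /esym/eqP; rewrite !mulf_eq0 (negPf two_neq0) (negPf x0) /=.
set s := split_inv A y z x in S0 *.
have -> : split_inv A z x y = - s by apply/eqP; rewrite -addr_eq0 addrC S0.
rewrite mulrN addrC subr_eq0 => /eqP ss.
have s_alg : alg [::] s by apply: alg_sqrt; rewrite expr2 -ss; apply: alg_cst.
have sE : s * split_den A y z x = y * z * x + A * (y - z - x).
  by rewrite /s divfK // den_neq0.
have y_alg : alg [:: y; z] y by apply: alg_mem; rewrite !inE eqxx.
have z_alg : alg [:: y; z] z by apply: alg_mem; rewrite !inE eqxx orbT.
have A_alg : alg [:: y; z] A by apply: alg_cst.
have s_alg' : alg [:: y; z] s by apply: alg_sub s_alg.
apply: x_tr; apply: (@alg_linear _ _ _ _ (y * z - A - s * (y - z))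
  (A * (y - z) - s * (y * z - A))); try by alg_tac.
  by rewrite -(subrr (s * split_den A y z x)) {1}sE /split_den; ring.
by left; apply: coef_neq0 yzx s_alg.
Qed.

Variables (x1 x2 x3 : K).
Hypotheses (x_indep : indep [::] [:: x1; x2; x3])
  (x_gen : forall f, gen [:: x1; x2; x3] f).
Hypotheses (tauk : forall c, tau (iota c) = iota c)
  (lamk : forall c, lam (iota c) = iota c)
  (sigk : forall c, sig (iota c) = iota c).
Hypotheses (tau1 : tau x1 = A / x1) (tau2 : tau x2 = A / x2) (tau3 : tau x3 = x3).
Hypotheses (lam1 : lam x1 = A / x1) (lam2 : lam x2 = x2) (lam3 : lam x3 = A / x3).
Hypotheses (sig1 : sig x1 = x2) (sig2 : sig x2 = x3) (sig3 : sig x3 = x1).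

(** By [split_inv_sum] the traces [x + A / x] lie in [gen T], so the differences [p1] and [p2] have
    squares there. Over [T] these two yield [x1] and [x2], and [x3] follows from the equation
    defining [y1], which is linear in [x3]. *)
Lemma split_fixed_field :
  exists T1 T2 T3, indep [::] [:: T1; T2; T3] /\
    forall f, tau f = f /\ lam f = f /\ sig f = f <-> gen [:: T3; T2; T1] f.
Proof.
have i231 : indep [::] [:: x2; x3; x1].
  by apply: indep_perm x_indep; rewrite perm_sym (perm_rot 1 [:: x1; x2; x3]).
have i312 : indep [::] [:: x3; x1; x2].
  by apply: indep_perm x_indep; rewrite perm_sym (perm_rot 2 [:: x1; x2; x3]).
have nz x y z : indep [::] [:: x; y; z] -> x != 0.
  move=> /indep_not_alg [x_tr _ _]; apply/eqP => x0; apply: x_tr.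
  by rewrite x0; apply/alg_gen/gen0.
have n1 := nz _ _ _ x_indep; have n2 := nz _ _ _ i231; have n3 := nz _ _ _ i312.
have d1 := den_neq0 x_indep; have d2 := den_neq0 i231; have d3 := den_neq0 i312.
have morph_inv (s : {rmorphism K -> K}) x y z : (forall c, s (iota c) = iota c) ->
    s (split_inv A x y z) = split_inv A (s x) (s y) (s z).
  move=> sk; rewrite /split_inv /split_den fmorph_div.
  by rewrite !(rmorphB, rmorphD, rmorphM) /= sk.
pose y1 := split_inv A x1 x2 x3; pose y2 := split_inv A x2 x3 x1.
pose y3 := split_inv A x3 x1 x2; pose T := [:: y1; y2; y3].
have g1 : gen T y1 by exact/gen_mem/mem_fst.
have g2 : gen T y2 by exact/gen_mem/mem_snd.
have g3 : gen T y3 by exact/gen_mem/mem_thd.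
have gA S : gen S A by apply: gen_cst.
have tauT y : y \in T -> tau y = y.
  rewrite !inE => /or3P[]/eqP->; rewrite morph_inv // tau1 tau2 tau3.
  - exact: split_inv12.
  - exact: split_inv13.
  - exact: split_inv23.
have lamT y : y \in T -> lam y = y.
  rewrite !inE => /or3P[]/eqP->; rewrite morph_inv // lam1 lam2 lam3.
  - exact: split_inv13.
  - exact: split_inv23.
  - exact: split_inv12.
have trace x y z : indep [::] [:: x; y; z] -> x + A / x
    = 2%:R * (split_inv A y z x * split_inv A z x y + A)
      / (split_inv A y z x + split_inv A z x y).
  move=> xyz; have x0 := nz _ _ _ xyz; have s0 := sum_neq0 xyz.
  have yzx : indep [::] [:: y; z; x].
    by apply: indep_perm xyz; rewrite perm_sym (perm_rot 1 [:: x; y; z]).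
  have zxy : indep [::] [:: z; x; y].
    by apply: indep_perm xyz; rewrite perm_sym (perm_rot 2 [:: x; y; z]).
  apply: (mulIf s0); rewrite divfK //; apply: (mulfI x0).
  rewrite [RHS]mulrCA [RHS]mulrA -(split_inv_sum (den_neq0 yzx) (den_neq0 zxy)).
  have -> : x ^+ 2 + A = x * (x + A / x) by field.
  by rewrite mulrA [LHS]mulrC.
pose p1 := x1 - A / x1; pose p2 := x2 - A / x2.
have tr1 : gen T (x1 + A / x1) by rewrite (trace _ _ _ x_indep); have := gA T => TA; gen_tac.
have tr2 : gen T (x2 + A / x2) by rewrite (trace _ _ _ i231); have := gA T => TA; gen_tac.
have half x : x = (x - A / x + (x + A / x)) / 2%:R.
  by apply: (mulIf two_neq0); rewrite divfK //; ring.
have x3E : x3 * (x1 * x2 - A - y1 * (x1 - x2))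
            = y1 * (x1 * x2 - A) - A * (x1 - x2).
  have : y1 * split_den A x1 x2 x3 = x1 * x2 * x3 + A * (x1 - x2 - x3).
    by rewrite /y1 divfK.
  move=> E; apply/eqP; rewrite -subr_eq0; apply/eqP.
  by rewrite -(subrr (y1 * split_den A x1 x2 x3)) {1}E /split_den; ring.
(* If this coefficient of [x3] vanished, [x3E] would give [y1 ^+ 2 = A], and [coef_neq0] would apply
   with [s = y1]. *)
have c0 : x1 * x2 - A - y1 * (x1 - x2) != 0.
  apply/eqP => c0; have : alg [::] y1; last first.
    by move=> /(coef_neq0 x_indep); rewrite c0 eqxx.
  apply: alg_sqrt; have -> : y1 ^+ 2 = A; last exact: alg_cst.
  have x12 : x1 - x2 != 0.
    rewrite subr_eq0; apply/eqP => x12; have [x_tr _ _] := indep_not_alg x_indep.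
    by apply: x_tr; rewrite x12; apply: alg_mem; rewrite mem_head.
  move: x3E; rewrite c0 mulr0 => E; apply: (mulIf x12).
  rewrite -[RHS]addr0 E; move/eqP: c0; rewrite subr_eq0 => /eqP ->.
  by ring.
have gx (S : seq K) : gen S y1 -> gen S p1 -> gen S p2 ->
    gen S (x1 + A / x1) -> gen S (x2 + A / x2) -> {in [:: x1; x2; x3], forall x, gen S x}.
  move=> Sy1 Sp1 Sp2 St1 St2.
  have Sx1 : gen S x1 by rewrite (half x1) -/p1; gen_tac.
  have Sx2 : gen S x2 by rewrite (half x2) -/p2; gen_tac.
  have Sx3 : gen S x3.
    by rewrite -(mulfK c0 x3) x3E; have := gA S => SA; gen_tac.
  by move=> x; rewrite !inE => /or3P[]/eqP->.
have sqr x : x != 0 -> (x - A / x) ^+ 2 = (x + A / x) ^+ 2 - 4%:R * A.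
  by move=> x0; field.
have sq1 : gen T (p1 ^+ 2).
  by rewrite /p1 sqr //; have := gA T => TA; gen_tac.
have sq2 : gen T (p2 ^+ 2).
  by rewrite /p2 sqr //; have := gA T => TA; gen_tac.
have inv_inv x : x != 0 -> A / (A / x) = x.
  by move=> x0; rewrite invf_div mulrCA divff // mulr1.
have ga x : gen T x -> alg T x by apply: alg_gen.
apply: (@cyclic_descent _ _ iota two_neq0 tau lam sig [:: x1; x2; x3] y1 y2 y3)
  => //; try by rewrite morph_inv // sig1 sig2 sig3.
  have gT' z : gen T z -> gen [:: p1, p2 & T] z.
    by apply: gen_sub => w; rewrite !inE => ->; rewrite !orbT.
  have ap1 : alg T p1 by apply/alg_sqrt/ga.
  have ap2 : alg T p2 by apply/alg_sqrt/ga.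
  move=> x /(gx [:: p1, p2 & T]) Gx; apply: gen_alg (Gx _ _ _ _ _).
  - by move=> y; rewrite !inE => /or3P[/eqP->|/eqP->|Ty] //; apply: alg_mem; rewrite !inE.
  - exact: gT'.
  - by apply: gen_mem; rewrite mem_head.
  - by apply: gen_mem; rewrite !inE eqxx orbT.
  - exact: gT'.
  - exact: gT'.
move=> f; apply: (@fixed_biquadratic _ _ iota T tau lam p1 p2 two_neq0).
- by move=> x; apply: gen_fixed.
- by move=> x; apply: gen_fixed.
- by rewrite /p1 rmorphB fmorph_div tau1 tauk inv_inv // opprB.
- by rewrite /p1 rmorphB fmorph_div lam1 lamk inv_inv // opprB.
- by rewrite /p2 rmorphB fmorph_div tau2 tauk inv_inv // opprB.
- by rewrite /p2 rmorphB fmorph_div lam2 lamk.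
- exact: sq1.
- exact: sq2.
have gT' z : gen T z -> gen [:: p1, p2 & T] z.
  by apply: gen_sub => w; rewrite !inE => ->; rewrite !orbT.
apply: gen_trans (x_gen f); apply: gx; try exact: gT'.
- by apply: gen_mem; rewrite mem_head.
- by apply: gen_mem; rewrite !inE eqxx orbT.
Qed.

End SplitFixedField.

(** * The case epsilon = -1 *)


Section Vectors.
Variables (K : fieldType) (d r s : K).
Variables (p1 q1 p2 q2 p3 q3 : K).

(* (vec1, vec2, vec3) is the vector a of the header.  Write r = m - n, s = m + n,
   so that (1, m, n) is a rational point of the quadric B(u,u) = 0: up to a
   homography, slope is the direction of a seen from that point, and height is
   the inverse of the position of a on the corresponding line. *)
Definition vec1 := p1 * q3 - q2 * q3 - p1 * p2.
Definition vec2 := p3 * (d + p1 * q2).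
Definition vec3 := q1 * (d + p2 * q3).
Definition vecE := d * vec1 + r * vec2 + s * vec3.
Definition vecF := d * vec1 + s * vec2 - r * vec3.
Definition slope := vecE / vecF.
Definition height := - (d * vec1) / vecF.

Hypotheses (c1 : p1 ^+ 2 + q1 ^+ 2 + d = 0) (c2 : p2 ^+ 2 + q2 ^+ 2 + d = 0)
  (c3 : p3 ^+ 2 + q3 ^+ 2 + d = 0).

(** The two factors on the right also occur in [vec2 * vec3], so the quotient of the two expressions
    isolates [p3 * q1]; see [gen_mix]. *)
Lemma vec_norm : vec2 ^+ 2 + vec3 ^+ 2 - d * vec1 ^+ 2
  = - (2%:R * d * (d + p1 * q2) * (d + p2 * q3)).
Proof.
apply/eqP; rewrite -subr_eq0 opprK; apply/eqP.
(* Explicit cofactors placing the difference of the two sides in the ideal of the three conic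
   equations. *)
transitivity ((d + p2 * q3) ^+ 2 * (p1 ^+ 2 + q1 ^+ 2 + d)
  + (p1 ^+ 2 * p3 ^+ 2 - d * q3 ^+ 2) * (p2 ^+ 2 + q2 ^+ 2 + d)
  + (d ^+ 2 - d * p1 ^+ 2 + 2%:R * d * p1 * q2 - p1 ^+ 2 * p2 ^+ 2)
      * (p3 ^+ 2 + q3 ^+ 2 + d)).
  by rewrite /vec1 /vec2 /vec3; ring.
by rewrite c1 c2 c3 !mulr0 !addr0.
Qed.

End Vectors.

Section VectorPairs.
Variables (K : fieldType) (d r s : K).
Variables (p1 q1 p2 q2 p3 q3 : K).
Hypotheses (c1 : p1 ^+ 2 + q1 ^+ 2 + d = 0) (c2 : p2 ^+ 2 + q2 ^+ 2 + d = 0)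
  (c3 : p3 ^+ 2 + q3 ^+ 2 + d = 0).
Hypothesis rs : r ^+ 2 + s ^+ 2 + 2%:R * d = 0.

Local Notation a1 := (vec1 p1 p2 q2 q3).
Local Notation a2 := (vec2 d p1 q2 p3).
Local Notation a3 := (vec3 d q1 p2 q3).
Local Notation b1 := (vec1 p2 p3 q3 q1).
Local Notation b2 := (vec2 d p2 q3 p1).
Local Notation b3 := (vec3 d q2 p3 q1).

(** This is [B(a,b) = 0], again by explicit cofactors of the conic equations; cyclic shifts of the
    indices give the other two. *)
Lemma vec_orthogonal :
  d * a1 * b1 + a2 * b2 + a3 * b3 + a2 * b3 - a3 * b2 = 0.
Proof.
transitivity ((d + p2 * q3) * (p3 * q2) * (p1 ^+ 2 + q1 ^+ 2 + d)
  + p1 * p3 * (d + p3 * q1) * (p2 ^+ 2 + q2 ^+ 2 + d)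
  + (d * q1 * q2 - d * p1 * q1 - p1 * p2 ^+ 2 * q1) * (p3 ^+ 2 + q3 ^+ 2 + d)).
  by rewrite /vec1 /vec2 /vec3; ring.
by rewrite c1 c2 c3 !mulr0 !addr0.
Qed.

Local Notation Sa := (slope d r s p1 q1 p2 q2 p3 q3).
Local Notation Sb := (slope d r s p2 q2 p3 q3 p1 q1).
Local Notation ha := (height d r s p1 q1 p2 q2 p3 q3).
Local Notation hb := (height d r s p2 q2 p3 q3 p1 q1).

(** [B(a,b) = 0] in the projected coordinates: the isotropy condition [rs] makes the relation linear
    in the heights once the slopes are given. *)
Lemma slope_height_rel :
  vecF d r s p1 q1 p2 q2 p3 q3 != 0 -> vecF d r s p2 q2 p3 q3 p1 q1 != 0 ->
  2%:R * (hb + Sb * ha) + (1 + Sb - Sa + Sa * Sb) = 0.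
Proof.
rewrite /slope /height /vecF /vecE.
move: vec_orthogonal; move: a1 a2 a3 b1 b2 b3 => u1 u2 u3 v1 v2 v3 uv Fa Fb.
transitivity ((- (2%:R * d)
    * (d * u1 * v1 + u2 * v2 + u3 * v3 + u2 * v3 - u3 * v2)
  + (r ^+ 2 + s ^+ 2 + 2%:R * d) * (u2 * v2 + u3 * v3 + u2 * v3 - u3 * v2))
  / ((d * u1 + s * u2 - r * u3) * (d * v1 + s * v2 - r * v3))).
  by field; rewrite Fa Fb.
by rewrite uv rs mulr0 mul0r addr0 mul0r.
Qed.

End VectorPairs.

(** * Denominators do not vanish at independent points of the conic *)

Section NonVanishing.
Variables (k K : fieldType) (iota : {rmorphism k -> K}) (d r s : k).
Hypothesis two_neq0 : 2%:R != 0 :> K.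
Hypothesis d_neq0 : d != 0.
Local Notation gen := (gen iota).
Local Notation alg := (alg iota).
Local Notation indep := (indep iota).
Local Notation D := (iota d).
Local Notation R := (iota r).
Local Notation S := (iota s).

Variables (p1 q1 p2 q2 p3 q3 : K).
Hypotheses (c1 : p1 ^+ 2 + q1 ^+ 2 + D = 0) (c2 : p2 ^+ 2 + q2 ^+ 2 + D = 0)
  (c3 : p3 ^+ 2 + q3 ^+ 2 + D = 0).
Hypothesis p_indep : indep [::] [:: p1; p2; p3].

Lemma conic_alg T p q : p ^+ 2 + q ^+ 2 + D = 0 -> alg T p -> alg T q.
Proof.
move=> E Tp; apply: alg_sqrt.
have -> : q ^+ 2 = - (p ^+ 2 + D).
  by apply/eqP; rewrite -addr_eq0 addrCA addrA E.
have aD : alg T D by apply: alg_cst.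
by alg_tac.
Qed.

Lemma conic_algC T p q : p ^+ 2 + q ^+ 2 + D = 0 -> alg T q -> alg T p.
Proof. by rewrite [p ^+ 2 + _]addrC; apply: conic_alg. Qed.

Let p1_tr : ~ alg [:: p2; p3] p1. Proof. by have [] := indep_not_alg p_indep. Qed.
Let p2_tr : ~ alg [:: p3; p1] p2. Proof. by have [] := indep_not_alg p_indep. Qed.
Let p3_tr : ~ alg [:: p1; p2] p3. Proof. by have [] := indep_not_alg p_indep. Qed.

Let alg0' T : alg T 0. Proof. exact/alg_gen/gen0. Qed.

Lemma conic_neq0 : [/\ p1 != 0, q1 != 0, p2 != 0 & q2 != 0] /\ p3 != 0 /\ q3 != 0.
Proof.
split; [split|split]; apply/eqP => E.
- by apply: p1_tr; rewrite E.
- by apply: p1_tr; apply: conic_algC c1 _; rewrite E.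
- by apply: p2_tr; rewrite E.
- by apply: p2_tr; apply: conic_algC c2 _; rewrite E.
- by apply: p3_tr; rewrite E.
- by apply: p3_tr; apply: conic_algC c3 _; rewrite E.
Qed.

Lemma conic_mix_neq0 : D + p1 * q2 != 0.
Proof.
apply/eqP => E; apply: p1_tr.
have [[_ _ _ q20] _] := conic_neq0.
have a2 : alg [:: p2; p3] p2 by apply: alg_mem; rewrite mem_head.
have b2 := conic_alg c2 a2.
have aD : alg [:: p2; p3] D by apply: alg_cst.
apply: (@alg_linear _ _ _ _ q2 D) => //; last by left.
by rewrite -[RHS]E; ring.
Qed.

Lemma vec1_neq0 : vec1 p1 p2 q2 q3 != 0.
Proof.
apply/eqP => E; apply: p1_tr.
have a2 : alg [:: p2; p3] p2 by apply: alg_mem; rewrite mem_head.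
have a3 : alg [:: p2; p3] p3 by apply: alg_mem; rewrite !inE eqxx orbT.
have b2 := conic_alg c2 a2; have b3 := conic_alg c3 a3.
apply: (@alg_linear _ _ _ _ (q3 - p2) (- (q2 * q3))); try by alg_tac.
  by rewrite -[RHS]E /vec1; ring.
left; rewrite subr_eq0; apply/eqP => q3p2; apply: p2_tr; rewrite -q3p2.
by apply: conic_alg c3 _; apply: alg_mem; rewrite mem_head.
Qed.

(** [vecF] has the form [u p1 + w - v q1] with coefficients algebraic over [p2] and [p3]. If it
    vanished, eliminating [q1] through the conic would leave a quadratic equation for [p1]. That
    equation is nontrivial because [w != 0]: otherwise [q2] would be [S * p3 / q3]. *)
Lemma vecF_neq0 : vecF D R S p1 q1 p2 q2 p3 q3 != 0.
Proof.
apply/eqP => E; apply: p1_tr.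
have [_ [p30 q30]] := conic_neq0.
have a2 : alg [:: p2; p3] p2 by apply: alg_mem; rewrite mem_head.
have a3 : alg [:: p2; p3] p3 by apply: alg_mem; rewrite !inE eqxx orbT.
have b2 := conic_alg c2 a2; have b3 := conic_alg c3 a3.
have aD : alg [:: p2; p3] D by apply: alg_cst.
have aR : alg [:: p2; p3] R by apply: alg_cst.
have aS : alg [:: p2; p3] S by apply: alg_cst.
pose u := D * (q3 - p2) + S * p3 * q2.
pose v := R * (D + p2 * q3).
pose w := D * (S * p3 - q2 * q3).
have au : alg [:: p2; p3] u by rewrite /u; alg_tac.
have av : alg [:: p2; p3] v by rewrite /v; alg_tac.
have aw : alg [:: p2; p3] w by rewrite /w; alg_tac.
have w0 : w != 0.
  rewrite mulf_neq0 ?fmorph_eq0 // subr_eq0; apply/eqP => Ew.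
  apply: p2_tr; apply: conic_algC c2 _.
  have a3' : alg [:: p3; p1] p3 by apply: alg_mem; rewrite mem_head.
  have b3' := conic_alg c3 a3'.
  have aS' : alg [:: p3; p1] S by apply: alg_cst.
  by rewrite -(mulfK q30 q2) -Ew; alg_tac.
have uvw : u * p1 + w = v * q1.
  apply/eqP; rewrite -subr_eq0 -[X in _ == X]E; apply/eqP.
  by rewrite /u /v /w /vecF /vec1 /vec2 /vec3; ring.
apply: (@alg_quadratic _ _ _ _ (u ^+ 2 + v ^+ 2) (2%:R * (u * w))
  (w ^+ 2 + D * v ^+ 2)); try by alg_tac.
  transitivity ((u * p1 + w) ^+ 2 - (v * q1) ^+ 2
                + v ^+ 2 * (p1 ^+ 2 + q1 ^+ 2 + D)); first by ring.
  by rewrite uvw c1 subrr mulr0 addr0.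
have [u0|u0] := eqVneq u 0; last first.
  by constructor 2; apply: mulf_neq0 two_neq0 (mulf_neq0 u0 w0).
have [v0|v0] := eqVneq v 0.
  by constructor 3; rewrite v0 expr0n mulr0 addr0 expf_neq0.
by constructor 1; rewrite u0 expr0n add0r expf_neq0.
Qed.

End NonVanishing.


(** * Recovering the conic points from slopes and heights *)

Section Recovery.
Variables (k K : fieldType) (iota : {rmorphism k -> K}) (d r s : k).
Hypothesis two_neq0 : 2%:R != 0 :> K.
Hypothesis d_neq0 : d != 0.
Hypothesis rs : r ^+ 2 + s ^+ 2 + 2%:R * d = 0.
Local Notation gen := (gen iota).
Local Notation alg := (alg iota).
Local Notation indep := (indep iota).
Local Notation D := (iota d).
Local Notation R := (iota r).
Local Notation S := (iota s).

Let D_neq0 : D != 0. Proof. by rewrite fmorph_eq0. Qed.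

Let RS : R ^+ 2 + S ^+ 2 + 2%:R * D = 0.
Proof. by rewrite -!rmorphXn -(rmorph_nat iota) -rmorphM -!rmorphD rs rmorph0. Qed.

Section OneVector.
Variables (p1 q1 p2 q2 p3 q3 : K).
Hypotheses (c1 : p1 ^+ 2 + q1 ^+ 2 + D = 0) (c2 : p2 ^+ 2 + q2 ^+ 2 + D = 0)
  (c3 : p3 ^+ 2 + q3 ^+ 2 + D = 0).
Hypothesis p_indep : indep [::] [:: p1; p2; p3].
Variable T : seq K.
Hypotheses (T_slope : gen T (slope D R S p1 q1 p2 q2 p3 q3))
  (T_height : gen T (height D R S p1 q1 p2 q2 p3 q3)).
Local Notation a1 := (vec1 p1 p2 q2 q3).
Local Notation a2 := (vec2 D p1 q2 p3).
Local Notation a3 := (vec3 D q1 p2 q3).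
Local Notation al2 := (a2 / a1).
Local Notation al3 := (a3 / a1).

Let a1_neq0 : a1 != 0. Proof. exact: vec1_neq0 c2 c3 p_indep. Qed.
Let F_neq0 : vecF D R S p1 q1 p2 q2 p3 q3 != 0.
Proof. exact: vecF_neq0 c1 c2 c3 p_indep. Qed.

Let gD : gen T D. Proof. exact: gen_cst. Qed.
Let gR : gen T R. Proof. exact: gen_cst. Qed.
Let gS : gen T S. Proof. exact: gen_cst. Qed.

Let slope_height : slope D R S p1 q1 p2 q2 p3 q3 / height D R S p1 q1 p2 q2 p3 q3
  = - (vecE D R S p1 q1 p2 q2 p3 q3 / (D * a1)).
Proof.
move: F_neq0 a1_neq0; rewrite /slope /height.
move: (vecE _ _ _ _ _ _ _ _ _) (vecF _ _ _ _ _ _ _ _ _) a1 => e f v f0 v0.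
by field; rewrite oppr_eq0 mulf_eq0 negb_or f0 v0 D_neq0.
Qed.

Let height_inv : (height D R S p1 q1 p2 q2 p3 q3)^-1
  = - (vecF D R S p1 q1 p2 q2 p3 q3 / (D * a1)).
Proof.
move: F_neq0 a1_neq0; rewrite /height.
move: (vecF _ _ _ _ _ _ _ _ _) a1 => f v f0 v0.
by field; rewrite ?oppr_eq0 ?mulf_eq0 ?negb_or f0 v0 D_neq0.
Qed.

(** Divided by [D * a1], [vecE] and [vecF] are affine in the ratios [al2] and [al3]. Since
    [R ^+ 2 + S ^+ 2 = - 2 D], the linear part has determinant [2 / D]; its inverse is written out
    here and in [gen_vec3]. *)
Lemma gen_vec2 : gen T al2.
Proof.
have E : 2%:R * al2 = R * (slope D R S p1 q1 p2 q2 p3 q3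
    / height D R S p1 q1 p2 q2 p3 q3 + 1)
    + S * ((height D R S p1 q1 p2 q2 p3 q3)^-1 + 1).
  rewrite slope_height height_inv /vecE /vecF.
  move: a1_neq0; move: a1 a2 a3 => u1 u2 u3 u0.
  transitivity (2%:R * (u2 / u1) - (R ^+ 2 + S ^+ 2 + 2%:R * D) * (u2 / (D * u1))).
    by rewrite RS mul0r subr0.
  by field; rewrite u0 D_neq0.
by rewrite -(mulKf two_neq0 al2) E; gen_tac.
Qed.

Lemma gen_vec3 : gen T al3.
Proof.
have E : 2%:R * al3 = S * (slope D R S p1 q1 p2 q2 p3 q3
    / height D R S p1 q1 p2 q2 p3 q3 + 1)
    - R * ((height D R S p1 q1 p2 q2 p3 q3)^-1 + 1).
  rewrite slope_height height_inv /vecE /vecF.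
  move: a1_neq0; move: a1 a2 a3 => u1 u2 u3 u0.
  transitivity (2%:R * (u3 / u1) - (R ^+ 2 + S ^+ 2 + 2%:R * D) * (u3 / (D * u1))).
    by rewrite RS mul0r subr0.
  by field; rewrite u0 D_neq0.
by rewrite -(mulKf two_neq0 al3) E; gen_tac.
Qed.

Hypotheses (mix1 : D + p1 * q2 != 0) (mix2 : D + p2 * q3 != 0).

(** Comparing [vec_norm] with [a2 * a3] cancels the two mixed factors and [a1 ^+ 2]. *)
Lemma gen_mix : gen T (p3 * q1).
Proof.
have g2 := gen_vec2; have g3 := gen_vec3.
have norm : (al2 ^+ 2 + al3 ^+ 2 - D) * a1 ^+ 2
    = - (2%:R * D * (D + p1 * q2) * (D + p2 * q3)).
  by rewrite -(vec_norm c1 c2 c3); field.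
have prod : al2 * al3 * a1 ^+ 2 = p3 * q1 * ((D + p1 * q2) * (D + p2 * q3)).
  rewrite [LHS](_ : _ = a2 * a3); first by rewrite /vec2 /vec3; ring.
  by field.
have n0 : al2 ^+ 2 + al3 ^+ 2 - D != 0.
  apply/eqP => E; move: norm; rewrite E mul0r => /esym/eqP.
  by rewrite oppr_eq0 !mulf_eq0 (negPf two_neq0) (negPf D_neq0) (negPf mix1) (negPf mix2).
have -> : p3 * q1 = - (2%:R * D * (al2 * al3)) / (al2 ^+ 2 + al3 ^+ 2 - D).
  apply: (mulIf n0); rewrite divfK //.
  have m0 : (D + p1 * q2) * (D + p2 * q3) != 0 by rewrite mulf_neq0.
  have s0 : a1 ^+ 2 != 0 by rewrite expf_neq0.
  apply: (mulIf s0); rewrite -mulrA norm.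
  transitivity (- (2%:R * D * (al2 * al3 * a1 ^+ 2))); last by ring.
  by rewrite prod; ring.
by gen_tac.
Qed.

Hypotheses (p3_neq0 : p3 != 0) (q1_neq0 : q1 != 0).
Hypotheses (gen_mix1 : gen T (p1 * q2)) (gen_mix2 : gen T (p2 * q3)).

Lemma gen_conic_ratio : gen T (p3 / q1).
Proof.
have g2 := gen_vec2; have g3 := gen_vec3.
have -> : p3 / q1 = al2 / al3 * ((D + p2 * q3) / (D + p1 * q2)).
  move: a1_neq0; rewrite /vec2 /vec3; move: a1 => u u0.
  by field; rewrite mix1 mix2 u0 q1_neq0.
by gen_tac.
Qed.

(** The quotient [a1 / (p1 * p2)] is a polynomial in [q2 / p1] and [q3 / p2]; multiplying it by
    [al2] replaces [a1] by [a2 = p3 * (D + p1 * q2)]. *)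
Lemma gen_conic_prod : p1 != 0 -> p2 != 0 -> q2 != 0 -> q3 != 0 ->
  gen T (p1 / q2) -> gen T (p2 / q3) -> gen T (p3 / (p1 * p2)).
Proof.
move=> p10 p20 q20 q30 r1 r2; have g2 := gen_vec2.
have -> : p3 / (p1 * p2)
    = al2 * ((p2 / q3)^-1 - (p1 / q2)^-1 * (p2 / q3)^-1 - 1) / (D + p1 * q2).
  move: a1_neq0; rewrite /vec2 => u0.
  have -> : (p2 / q3)^-1 - (p1 / q2)^-1 * (p2 / q3)^-1 - 1 = a1 / (p1 * p2).
    by rewrite /vec1 !invf_div; field; rewrite p10 p20.
  by move: u0; move: a1 => u u0; field; rewrite mix1 u0 p10 p20.
by gen_tac.
Qed.

End OneVector.

End Recovery.


(** * The fixed field generated by the slopes, for epsilon = -1 *)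

Section TwistedFixedField.
Variables (k K : fieldType) (iota : {rmorphism k -> K}) (d r s : k).
Hypothesis two_neq0 : 2%:R != 0 :> K.
Hypothesis d_neq0 : d != 0.
Hypothesis rs : r ^+ 2 + s ^+ 2 + 2%:R * d = 0.
Local Notation gen := (gen iota).
Local Notation alg := (alg iota).
Local Notation indep := (indep iota).
Local Notation D := (iota d).
Local Notation R := (iota r).
Local Notation S := (iota s).

Variables (p1 q1 p2 q2 p3 q3 : K).
Hypotheses (c1 : p1 ^+ 2 + q1 ^+ 2 + D = 0) (c2 : p2 ^+ 2 + q2 ^+ 2 + D = 0)
  (c3 : p3 ^+ 2 + q3 ^+ 2 + D = 0).
Variable xs : seq K.
Hypotheses (xs_indep : indep [::] xs) (xs_size : size xs = 3%N).
Hypothesis all_gen : forall f, gen [:: p1; p2; p3; q1; q2; q3] f.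
Variables (tau lam sig : {rmorphism K -> K}).
Hypotheses (tauk : forall c, tau (iota c) = iota c)
  (lamk : forall c, lam (iota c) = iota c)
  (sigk : forall c, sig (iota c) = iota c).
Hypotheses (tau_p1 : tau p1 = - p1) (tau_q1 : tau q1 = q1)
  (tau_p2 : tau p2 = - p2) (tau_q2 : tau q2 = - q2)
  (tau_p3 : tau p3 = p3) (tau_q3 : tau q3 = - q3).
Hypotheses (lam_p1 : lam p1 = - p1) (lam_q1 : lam q1 = - q1)
  (lam_p2 : lam p2 = p2) (lam_q2 : lam q2 = - q2)
  (lam_p3 : lam p3 = - p3) (lam_q3 : lam q3 = q3).
Hypotheses (sig_p1 : sig p1 = p2) (sig_p2 : sig p2 = p3) (sig_p3 : sig p3 = p1)
  (sig_q1 : sig q1 = q2) (sig_q2 : sig q2 = q3) (sig_q3 : sig q3 = q1).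

Let y1 := slope D R S p1 q1 p2 q2 p3 q3.
Let y2 := slope D R S p2 q2 p3 q3 p1 q1.
Let y3 := slope D R S p3 q3 p1 q1 p2 q2.
Let h1 := height D R S p1 q1 p2 q2 p3 q3.
Let h2 := height D R S p2 q2 p3 q3 p1 q1.
Let h3 := height D R S p3 q3 p1 q1 p2 q2.

Let i123 : indep [::] [:: p1; p2; p3].
Proof.
apply: spanning_indep xs_indep _ _ => // x _; apply: gen_alg (all_gen x).
have a1 : alg [:: p1; p2; p3] p1 by exact/alg_mem/mem_fst.
have a2 : alg [:: p1; p2; p3] p2 by exact/alg_mem/mem_snd.
have a3 : alg [:: p1; p2; p3] p3 by exact/alg_mem/mem_thd.
move=> y; rewrite !inE; do 5?[case/predU1P=> [->|]] => //.
- exact: conic_alg c1 a1.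
- exact: conic_alg c2 a2.
- by move=> /eqP->; exact: conic_alg c3 a3.
Qed.

Let i231 : indep [::] [:: p2; p3; p1].
Proof. by apply: indep_perm i123; rewrite perm_sym (perm_rot 1 [:: p1; p2; p3]). Qed.

Let i312 : indep [::] [:: p3; p1; p2].
Proof. by apply: indep_perm i123; rewrite perm_sym (perm_rot 2 [:: p1; p2; p3]). Qed.

Let rsK : R ^+ 2 + S ^+ 2 + 2%:R * D = 0.
Proof. by rewrite -!rmorphXn -(rmorph_nat iota) -rmorphM -!rmorphD rs rmorph0. Qed.

(** With [rel23] and [rel31] this is a linear system for the heights, whose determinant is
    [1 + y1 * y2 * y3] up to a power of 2. *)
Let rel12 : 2%:R * (h2 + y2 * h1) + (1 + y2 - y1 + y1 * y2) = 0.
Proof.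
apply: (slope_height_rel c1 c2 c3 rsK).
  exact: (vecF_neq0 r s two_neq0 d_neq0 c1 c2 c3 i123).
exact: (vecF_neq0 r s two_neq0 d_neq0 c2 c3 c1 i231).
Qed.

Let rel23 : 2%:R * (h3 + y3 * h2) + (1 + y3 - y2 + y2 * y3) = 0.
Proof.
apply: (slope_height_rel c2 c3 c1 rsK).
  exact: (vecF_neq0 r s two_neq0 d_neq0 c2 c3 c1 i231).
exact: (vecF_neq0 r s two_neq0 d_neq0 c3 c1 c2 i312).
Qed.

Let rel31 : 2%:R * (h1 + y1 * h3) + (1 + y1 - y3 + y3 * y1) = 0.
Proof.
apply: (slope_height_rel c3 c1 c2 rsK).
  exact: (vecF_neq0 r s two_neq0 d_neq0 c3 c1 c2 i312).
exact: (vecF_neq0 r s two_neq0 d_neq0 c1 c2 c3 i123).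
Qed.

Let nz : [/\ p1 != 0, q1 != 0, p2 != 0 & q2 != 0] /\ p3 != 0 /\ q3 != 0.
Proof. exact: conic_neq0 c1 c2 c3 i123. Qed.

Let mix12 : D + p1 * q2 != 0. Proof. exact: conic_mix_neq0 c1 c2 c3 i123. Qed.
Let mix23 : D + p2 * q3 != 0. Proof. exact: conic_mix_neq0 c2 c3 c1 i231. Qed.
Let mix31 : D + p3 * q1 != 0. Proof. exact: conic_mix_neq0 c3 c1 c2 i312. Qed.

(** The products [p1 * q2] and ratios [p1 / q2], with their cyclic shifts, lie in [gen T] and yield
    the squares. Adjoining [p1] and [p2] gives [p3] by [gen_conic_prod], then each [q] from its
    ratio. *)
Lemma gen_from_slopes T :
  gen T y1 -> gen T y2 -> gen T y3 -> gen T h1 -> gen T h2 -> gen T h3 ->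
  [/\ gen T (p1 ^+ 2), gen T (p2 ^+ 2) & forall f, gen [:: p1, p2 & T] f].
Proof.
move=> Y1 Y2 Y3 H1 H2 H3; have [[p10 q10 p20 q20] [p30 q30]] := nz.
have o3 : gen T (p3 * q1).
  by apply: (gen_mix two_neq0 d_neq0 rs c1 c2 c3 i123 Y1 H1).
have o1 : gen T (p1 * q2).
  by apply: (gen_mix two_neq0 d_neq0 rs c2 c3 c1 i231 Y2 H2).
have o2 : gen T (p2 * q3).
  by apply: (gen_mix two_neq0 d_neq0 rs c3 c1 c2 i312 Y3 H3).
have r3 : gen T (p3 / q1).
  by apply: (gen_conic_ratio two_neq0 d_neq0 rs c1 c2 c3 i123 Y1 H1).
have r1 : gen T (p1 / q2).
  by apply: (gen_conic_ratio two_neq0 d_neq0 rs c2 c3 c1 i231 Y2 H2).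
have r2 : gen T (p2 / q3).
  by apply: (gen_conic_ratio two_neq0 d_neq0 rs c3 c1 c2 i312 Y3 H3).
have pr : gen T (p3 / (p1 * p2)).
  by apply: (gen_conic_prod two_neq0 d_neq0 rs c1 c2 c3 i123 Y1 H1).
split.
- have -> : p1 ^+ 2 = p1 / q2 * (p1 * q2) by field.
  exact: genM.
- have -> : p2 ^+ 2 = p2 / q3 * (p2 * q3) by field.
  exact: genM.
pose U := [:: p1, p2 & T].
have TU x : gen T x -> gen U x.
  by apply: gen_sub => w; rewrite !inE => ->; rewrite !orbT.
have U1 : gen U p1 by apply: gen_mem; rewrite mem_head.
have U2 : gen U p2 by apply: gen_mem; rewrite !inE eqxx orbT.
have U3 : gen U p3.
  have -> : p3 = p3 / (p1 * p2) * (p1 * p2) by field; rewrite p10 p20.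
  by apply: genM; [exact: TU|exact: genM].
have V x y : x != 0 -> gen T (x / y) -> y != 0 -> gen U x -> gen U y.
  move=> x0 Txy y0 Ux; have -> : y = x / (x / y) by rewrite invf_div mulrCA divff ?mulr1.
  by apply: gen_div => //; apply: TU.
have W1 : gen U q1 by apply: (V p3).
have W2 : gen U q2 by apply: (V p1).
have W3 : gen U q3 by apply: (V p2).
move=> f; apply: gen_trans (all_gen f) => x.
by rewrite !inE; do 5?[case/predU1P=> [->|]] => // /eqP->.
Qed.

Lemma alg_from_slopes T :
  gen T y1 -> gen T y2 -> gen T y3 -> gen T h1 -> gen T h2 -> gen T h3 ->
  forall f, alg T f.
Proof.
move=> Y1 Y2 Y3 H1 H2 H3 f; have [s1 s2 G] := gen_from_slopes Y1 Y2 Y3 H1 H2 H3.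
apply: gen_alg (G f) => x; rewrite !inE => /or3P[/eqP->|/eqP->|Tx].
- exact/alg_sqrt/alg_gen.
- exact/alg_sqrt/alg_gen.
exact: alg_mem.
Qed.

(* Otherwise y1, y2, y3 would satisfy two independent relations, and the whole
   field would be algebraic over the two elements y1 and h1. *)
Lemma slope_prod_neq : 1 + y1 * y2 * y3 != 0.
Proof.
apply/eqP => w.
(* The compatibility condition of the now singular system, multiplied by [- y3] and simplified with
   [y1 * y2 * y3 = -1]. Its constant term 1 makes it a nontrivial equation for [y3] over [y1]. *)
have E : (1 - y1 + y1 ^+ 2) * y3 ^+ 2 + (y1 - 1) * y3 + 1 = 0.
  transitivity ((1 + y1 * y2 * y3) * (2%:R * h1 * y3 + 1 + y1 * y3)
    - y3 * (2%:R * (h1 + y1 * h3) + (1 + y1 - y3 + y3 * y1)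
    - y1 * (2%:R * (h3 + y3 * h2) + (1 + y3 - y2 + y2 * y3))
    + y1 * y3 * (2%:R * (h2 + y2 * h1) + (1 + y2 - y1 + y1 * y2)))).
    by ring.
  by rewrite w rel12 rel23 rel31 mul0r !mulr0 !(addr0, subr0) mulr0 subr0.
pose T := [:: y1; h1].
have a1 : alg T y1 by apply: alg_mem; rewrite mem_head.
have b1 : alg T h1 by apply: alg_mem; rewrite !inE eqxx orbT.
have a3 : alg T y3.
  apply: alg_quadratic E _; try by alg_tac.
  by constructor 3; apply: oner_neq0.
have y130 : y1 * y3 != 0.
  apply/eqP => y0; move: w; rewrite mulrAC y0 mul0r addr0 => /eqP.
  by rewrite oner_eq0.
have a2 : alg T y2.
  have -> : y2 = - (y1 * y3)^-1.
    apply: (mulfI y130); rewrite mulrN divff // mulrAC.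
    by apply/eqP; rewrite -addr_eq0 addrC w.
  by alg_tac.
have a_half : alg T 2%:R^-1 by apply/alg_gen/genV/gen_nat.
have b2 : alg T h2.
  have -> : h2 = - (2%:R^-1 * (1 + y2 - y1 + y1 * y2)) - y2 * h1.
    apply: (mulfI two_neq0); rewrite mulrBr mulrN mulVKf //.
    by apply/eqP; rewrite -subr_eq0 -[X in _ == X]rel12; apply/eqP; ring.
  by alg_tac.
have b3 : alg T h3.
  have -> : h3 = - (2%:R^-1 * (1 + y3 - y2 + y2 * y3)) - y3 * h2.
    apply: (mulfI two_neq0); rewrite mulrBr mulrN mulVKf //.
    by apply/eqP; rewrite -subr_eq0 -[X in _ == X]rel23; apply/eqP; ring.
  by alg_tac.
pose U := [:: y1; y2; y3; h1; h2; h3].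
have gU x : x \in U -> gen U x by apply: gen_mem.
have: (size xs <= size T)%N.
  apply: steinitz xs_indep _ => x _; rewrite cats0.
  have Ux : alg U x.
    by apply: alg_from_slopes; apply: gU; rewrite !inE eqxx ?orbT.
  apply: alg_trans Ux => y; rewrite !inE.
  by do 5?[case/predU1P=> [->|]] => // /eqP->.
by rewrite xs_size.
Qed.

Lemma twisted_fixed_field :
  exists T1 T2 T3, indep [::] [:: T1; T2; T3] /\
    forall f, tau f = f /\ lam f = f /\ sig f = f <-> gen [:: T3; T2; T1] f.
Proof.
pose T := [:: y1; y2; y3].
have g1 : gen T y1 by exact/gen_mem/mem_fst.
have g2 : gen T y2 by exact/gen_mem/mem_snd.
have g3 : gen T y3 by exact/gen_mem/mem_thd.
have gh1 : gen T h1.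
  (* Elimination of [h2] and [h3] from the three relations. *)
  have -> : h1 = (y1 * (1 + y3 - y2 + y2 * y3) - (1 + y1 - y3 + y3 * y1)
      - y1 * y3 * (1 + y2 - y1 + y1 * y2)) / (2%:R * (1 + y1 * y2 * y3)).
    have n0 : 2%:R * (1 + y1 * y2 * y3) != 0.
      exact: mulf_neq0 two_neq0 slope_prod_neq.
    apply: (mulIf n0); rewrite divfK //; apply/eqP; rewrite -subr_eq0; apply/eqP.
    transitivity (2%:R * (h1 + y1 * h3) + (1 + y1 - y3 + y3 * y1)
      - y1 * (2%:R * (h3 + y3 * h2) + (1 + y3 - y2 + y2 * y3))
      + y1 * y3 * (2%:R * (h2 + y2 * h1) + (1 + y2 - y1 + y1 * y2))).
      by ring.
    by rewrite rel12 rel23 rel31 !mulr0 subr0 addr0.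
  by gen_tac.
have gh2 : gen T h2.
  have -> : h2 = - (2%:R^-1 * (1 + y2 - y1 + y1 * y2)) - y2 * h1.
    apply: (mulfI two_neq0); rewrite mulrBr mulrN mulVKf //.
    by apply/eqP; rewrite -subr_eq0 -[X in _ == X]rel12; apply/eqP; ring.
  by gen_tac.
have gh3 : gen T h3.
  have -> : h3 = - (2%:R^-1 * (1 + y3 - y2 + y2 * y3)) - y3 * h2.
    apply: (mulfI two_neq0); rewrite mulrBr mulrN mulVKf //.
    by apply/eqP; rewrite -subr_eq0 -[X in _ == X]rel23; apply/eqP; ring.
  by gen_tac.
have [sq1 sq2 G] := gen_from_slopes g1 g2 g3 gh1 gh2 gh3.
have morph_slope (m : {rmorphism K -> K}) a b c e f g :
    (forall z, m (iota z) = iota z) ->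
    m (slope D R S a b c e f g) = slope D R S (m a) (m b) (m c) (m e) (m f) (m g).
  move=> mk; rewrite /slope /vecE /vecF /vec1 /vec2 /vec3 fmorph_div.
  by rewrite !(rmorphB, rmorphD, rmorphM) /= !mk.
(* The coordinates of each vector share one sign character, so numerator and denominator of a slope
   are both kept or both negated. *)
have tauT : {in T, forall y, tau y = y}.
  move=> y; rewrite !inE => /or3P[]/eqP->; rewrite /y1 /y2 /y3 morph_slope //
    tau_p1 tau_p2 tau_p3 tau_q1 tau_q2 tau_q3 /slope /vecE /vecF /vec1 /vec2 /vec3.
  - by congr (_ / _); ring.
  - by rewrite -[RHS]mulrNN -invrN; congr (_ / _); ring.
  by rewrite -[RHS]mulrNN -invrN; congr (_ / _); ring.
have lamT : {in T, forall y, lam y = y}.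
  move=> y; rewrite !inE => /or3P[]/eqP->; rewrite /y1 /y2 /y3 morph_slope //
    lam_p1 lam_p2 lam_p3 lam_q1 lam_q2 lam_q3 /slope /vecE /vecF /vec1 /vec2 /vec3.
  - by rewrite -[RHS]mulrNN -invrN; congr (_ / _); ring.
  - by rewrite -[RHS]mulrNN -invrN; congr (_ / _); ring.
  by congr (_ / _); ring.
apply: (@cyclic_descent _ _ iota two_neq0 tau lam sig xs y1 y2 y3) => //.
- by rewrite /y1 /y2 morph_slope // sig_p1 sig_p2 sig_p3 sig_q1 sig_q2 sig_q3.
- by rewrite /y2 /y3 morph_slope // sig_p1 sig_p2 sig_p3 sig_q1 sig_q2 sig_q3.
- by rewrite /y3 /y1 morph_slope // sig_p1 sig_p2 sig_p3 sig_q1 sig_q2 sig_q3.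
- by move=> x _; apply: alg_from_slopes.
move=> f; apply: (@fixed_biquadratic _ _ iota T tau lam p1 p2 two_neq0) => //.
- by move=> x; apply: gen_fixed.
- by move=> x; apply: gen_fixed.
Qed.

End TwistedFixedField.


(** * Parametrizing the conic when [a], [-a] or [-1] is a square *)

Section TwistedCases.
Variables (k K : fieldType) (iota : {rmorphism k -> K}).
Hypothesis two_neq0 : 2%:R != 0 :> K.
Local Notation gen := (gen iota).
Local Notation alg := (alg iota).
Local Notation indep := (indep iota).
Variables (a : k) (tau lam sig : {rmorphism K -> K}).
Hypothesis a_neq0 : a != 0.
Let A := iota a.
Let A_neq0 : A != 0. Proof. by rewrite fmorph_eq0. Qed.

Variables (x1 x2 x3 : K).
Hypotheses (x_indep : indep [::] [:: x1; x2; x3])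
  (x_gen : forall f, gen [:: x1; x2; x3] f).
Hypotheses (tauk : forall c, tau (iota c) = iota c)
  (lamk : forall c, lam (iota c) = iota c)
  (sigk : forall c, sig (iota c) = iota c).
Hypotheses (tau1 : tau x1 = A / x1) (tau2 : tau x2 = - (A / x2))
  (tau3 : tau x3 = - x3).
Hypotheses (lam1 : lam x1 = - (A / x1)) (lam2 : lam x2 = - x2)
  (lam3 : lam x3 = A / x3).
Hypotheses (sig1 : sig x1 = x2) (sig2 : sig x2 = x3) (sig3 : sig x3 = x1).

Let x_tr x : x \in [:: x1; x2; x3] -> ~ alg [::] x.
Proof.
have [t1 t2 t3] := indep_not_alg x_indep.
rewrite !inE => /or3P[]/eqP-> E; [apply: t1|apply: t2|apply: t3];
  exact: alg_sub E.
Qed.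

Let x_neq0 x : x \in [:: x1; x2; x3] -> x != 0.
Proof.
by move=> /x_tr tr; apply/eqP => x0; apply: tr; rewrite x0; apply/alg_gen/gen0.
Qed.

Let x_sqr_neq x c : x \in [:: x1; x2; x3] -> x ^+ 2 - iota c != 0.
Proof.
move=> /x_tr tr; rewrite subr_eq0; apply/eqP => E; apply: tr.
by apply: alg_sqrt; rewrite E; apply: alg_cst.
Qed.

Let m1 : x1 \in [:: x1; x2; x3] := mem_fst x1 x2 x3.
Let m2 : x2 \in [:: x1; x2; x3] := mem_snd x1 x2 x3.
Let m3 : x3 \in [:: x1; x2; x3] := mem_thd x1 x2 x3.

Let sqD x : x \in [:: x1; x2; x3] -> x ^+ 2 + A != 0.
Proof. by move=> /(@x_sqr_neq _ (- a)); rewrite rmorphN opprK. Qed.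

Let sqB x : x \in [:: x1; x2; x3] -> x ^+ 2 - A != 0.
Proof. exact: x_sqr_neq. Qed.

Local Notation goal :=
  (exists T1 T2 T3, indep [::] [:: T1; T2; T3] /\
    forall f, tau f = f /\ lam f = f /\ sig f = f <-> gen [:: T3; T2; T1] f).

(** [P] and [Q] send each variable to a point of the conic from which it can be recovered. The
    relabelling by [z1], [z2], [z3] lets each case match the fixed sign pattern of
    [twisted_fixed_field]. *)
Lemma twisted_case (d r s : k) (P Q : K -> K) (z1 z2 z3 : K) :
  d != 0 -> r ^+ 2 + s ^+ 2 + 2%:R * d = 0 ->
  (forall (m : {rmorphism K -> K}) x, (forall c, m (iota c) = iota c) ->
     m (P x) = P (m x) /\ m (Q x) = Q (m x)) ->
  (forall x, x \in [:: x1; x2; x3] -> P x ^+ 2 + Q x ^+ 2 + iota d = 0) ->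
  (forall x, x \in [:: x1; x2; x3] -> gen [:: P x; Q x] x) ->
  perm_eq [:: z1; z2; z3] [:: x1; x2; x3] ->
  sig z1 = z2 -> sig z2 = z3 -> sig z3 = z1 ->
  P (tau z1) = - P z1 -> Q (tau z1) = Q z1 ->
  P (tau z2) = - P z2 -> Q (tau z2) = - Q z2 ->
  P (tau z3) = P z3 -> Q (tau z3) = - Q z3 ->
  P (lam z1) = - P z1 -> Q (lam z1) = - Q z1 ->
  P (lam z2) = P z2 -> Q (lam z2) = - Q z2 ->
  P (lam z3) = - P z3 -> Q (lam z3) = Q z3 ->
  goal.
Proof.
move=> d0 rs PQ conic x_PQ zx s1 s2 s3 tp1 tq1 tp2 tq2 tp3 tq3 lp1 lq1 lp2 lq2 lp3 lq3.
have zm z : z \in [:: z1; z2; z3] -> z \in [:: x1; x2; x3] by rewrite (perm_mem zx).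
have Z1 := zm _ (mem_fst z1 z2 z3); have Z2 := zm _ (mem_snd z1 z2 z3).
have Z3 := zm _ (mem_thd z1 z2 z3).
have MP (m : {rmorphism K -> K}) x : (forall c, m (iota c) = iota c) -> m (P x) = P (m x).
  by move=> mk; case: (PQ m x mk).
have MQ (m : {rmorphism K -> K}) x : (forall c, m (iota c) = iota c) -> m (Q x) = Q (m x).
  by move=> mk; case: (PQ m x mk).
apply: (@twisted_fixed_field _ _ iota d r s two_neq0 d0 rs (P z1) (Q z1) (P z2) (Q z2)
  (P z3) (Q z3) _ _ _ [:: x1; x2; x3]); try exact: conic;
  rewrite ?(MP _ _ tauk) ?(MQ _ _ tauk) ?(MP _ _ lamk) ?(MQ _ _ lamk)
    ?(MP _ _ sigk) ?(MQ _ _ sigk) ?s1 ?s2 ?s3 //.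
move=> f; apply: gen_trans (x_gen f) => x.
rewrite -(perm_mem zx) !inE => /or3P[]/eqP->.
- by apply: gen_sub (x_PQ _ Z1) => y; rewrite !inE => /orP[]/eqP->; rewrite eqxx ?orbT.
- by apply: gen_sub (x_PQ _ Z2) => y; rewrite !inE => /orP[]/eqP->; rewrite eqxx ?orbT.
by apply: gen_sub (x_PQ _ Z3) => y; rewrite !inE => /orP[]/eqP->; rewrite eqxx ?orbT.
Qed.

Let mone_neq0 : (-1 : k) != 0. Proof. by rewrite oppr_eq0 oner_neq0. Qed.
Let mone_rs : 1 ^+ 2 + 1 ^+ 2 + 2%:R * -1 = 0 :> k. Proof. by ring. Qed.

Let ratio_cancel (c n e : K) : c != 0 -> c * n / (c * e) = n / e.
Proof. by move=> c0; rewrite -mulf_div divff ?mul1r. Qed.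

Let scale_neq0 x : x != 0 -> A / x ^+ 2 != 0.
Proof. by move=> x0; rewrite mulf_neq0 ?invr_eq0 ?expf_neq0. Qed.

Let inv_sqrD x : x != 0 -> (A / x) ^+ 2 + A = A / x ^+ 2 * (x ^+ 2 + A).
Proof. by move=> x0; field. Qed.

Let inv_sqrB x : x != 0 -> (A / x) ^+ 2 - A = A / x ^+ 2 * - (x ^+ 2 - A).
Proof. by move=> x0; field. Qed.

Let inv_lin x c : x != 0 -> c * (A / x) = A / x ^+ 2 * (c * x).
Proof. by move=> x0; field. Qed.

(** The usual parametrization of the unit circle by [x / b], with inverse [x = b Q / (1 - P)]; so
    [d = -1] and [r = s = 1]. *)
Lemma twisted_case_sqr b : a = b ^+ 2 -> goal.
Proof.
move=> ab; pose B := iota b; have AB : A = B ^+ 2 by rewrite /A ab rmorphXn.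
have B0 : B != 0 by apply: contraNneq A_neq0 => B0; rewrite AB B0 expr0n.
pose P x := (x ^+ 2 - A) / (x ^+ 2 + A).
pose Q x := 2%:R * B * x / (x ^+ 2 + A).
have PN x : P (- x) = P x by rewrite /P sqrrN.
have QN x : Q (- x) = - Q x by rewrite /Q sqrrN mulrN mulNr.
have PV x : x != 0 -> P (A / x) = - P x.
  by move=> x0; rewrite /P inv_sqrB // inv_sqrD // ratio_cancel ?scale_neq0 // mulNr.
have QV x : x != 0 -> Q (A / x) = Q x.
  by move=> x0; rewrite /Q inv_lin // inv_sqrD // ratio_cancel ?scale_neq0.
have n1 := x_neq0 m1; have n2 := x_neq0 m2; have n3 := x_neq0 m3.
apply: (@twisted_case (-1) 1 1 P Q x1 x2 x3) => //;
  rewrite ?tau1 ?tau2 ?tau3 ?lam1 ?lam2 ?lam3 ?PN ?QN ?PV ?QV //.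
- move=> m x mk; rewrite !fmorph_div.
  by rewrite !(rmorphB, rmorphD, rmorphM, rmorphXn, rmorph_nat) /= !mk.
- move=> x /sqD; rewrite rmorphN rmorph1 /P /Q AB => x0.
  by field; rewrite x0.
move=> x /sqD x0; have [u uE] : exists u, u = P x by exists (P x).
have [v vE] : exists v, v = Q x by exists (Q x).
rewrite -uE -vE.
have gu : gen [:: u; v] u by apply: gen_mem; rewrite mem_head.
have gv : gen [:: u; v] v by apply: gen_mem; rewrite !inE eqxx orbT.
have gB : gen [:: u; v] B by apply: gen_cst.
have -> : x = B * v / (1 - u).
  have -> : 1 - u = 2%:R * A / (x ^+ 2 + A) by rewrite uE /P; field; rewrite x0.
  rewrite vE /Q; move: x0; rewrite AB => x0.
  by field; rewrite x0 B0 two_neq0.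
by gen_tac.
Qed.

(** The unit circle again, with its coordinates exchanged. Now [x |-> A / x] negates both
    coordinates, so the sign pattern fits the order [x3], [x1], [x2]. *)
Lemma twisted_case_sqrN b : - a = b ^+ 2 -> goal.
Proof.
move=> ab; pose B := iota b; have AB : A = - B ^+ 2.
  by rewrite -rmorphXn -ab rmorphN opprK.
have B0 : B != 0 by apply: contraNneq A_neq0 => B0; rewrite AB B0 expr0n oppr0.
pose P x := 2%:R * B * x / (x ^+ 2 - A).
pose Q x := (x ^+ 2 + A) / (x ^+ 2 - A).
have PN x : P (- x) = - P x by rewrite /P sqrrN mulrN mulNr.
have QN x : Q (- x) = Q x by rewrite /Q sqrrN.
have PV x : x != 0 -> P (A / x) = - P x.
  move=> x0; rewrite /P inv_lin // inv_sqrB // ratio_cancel ?scale_neq0 //.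
  by rewrite invrN mulrN.
have QV x : x != 0 -> Q (A / x) = - Q x.
  move=> x0; rewrite /Q inv_sqrD // inv_sqrB // ratio_cancel ?scale_neq0 //.
  by rewrite invrN mulrN.
have n1 := x_neq0 m1; have n2 := x_neq0 m2; have n3 := x_neq0 m3.
apply: (@twisted_case (-1) 1 1 P Q x3 x1 x2) => //;
  rewrite ?tau1 ?tau2 ?tau3 ?lam1 ?lam2 ?lam3 ?PN ?QN ?PV ?QV ?opprK //.
- move=> m x mk; rewrite !fmorph_div.
  by rewrite !(rmorphB, rmorphD, rmorphM, rmorphXn, rmorph_nat) /= !mk.
- move=> x /sqB; rewrite rmorphN rmorph1 /P /Q AB => x0.
  by field.
- move=> x /sqB x0; have [u uE] : exists u, u = P x by exists (P x).
have [v vE] : exists v, v = Q x by exists (Q x).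
rewrite -uE -vE.
  have gu : gen [:: u; v] u by apply: gen_mem; rewrite mem_head.
  have gv : gen [:: u; v] v by apply: gen_mem; rewrite !inE eqxx orbT.
  have gB : gen [:: u; v] B by apply: gen_cst.
  have -> : x = B * u / (1 - v).
    have -> : 1 - v = 2%:R * B ^+ 2 / (x ^+ 2 - A).
      by rewrite vE /Q; move: x0; rewrite AB => x0; field.
    by rewrite uE /P; field; rewrite x0 B0 two_neq0.
  by gen_tac.
by rewrite (perm_rot 2 [:: x1; x2; x3]).
Qed.

(** As [I ^+ 2 = -1], the identity [(x + A / x)^2 - (x - A / x)^2 = 4 A] gives a point of the conic
    with [d = a], and [x = Q - I P]. *)
Lemma twisted_case_i (i : k) : i ^+ 2 = -1 -> goal.
Proof.
move=> i2; pose I := iota i; have I2 : I ^+ 2 = -1.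
  by rewrite /I -rmorphXn i2 rmorphN rmorph1.
have two0 : 2%:R != 0 :> k by move: two_neq0; rewrite -(rmorph_nat iota) fmorph_eq0.
have i0 : i != 0 by apply: contra_eq_neq i2 => ->; rewrite expr0n eq_sym oppr_eq0 oner_neq0.
pose P x := I * (x + A / x) / 2%:R; pose Q x := (x - A / x) / 2%:R.
have dN x : A / (- x) = - (A / x) by rewrite invrN mulrN.
have dV x : A / (A / x) = x by rewrite invf_div mulrCA divff // mulr1.
have PN x : P (- x) = - P x by rewrite /P dN; ring.
have QN x : Q (- x) = - Q x by rewrite /Q dN; ring.
have PV x : P (A / x) = P x by rewrite /P dV [A / x + x]addrC.
have QV x : Q (A / x) = - Q x by rewrite /Q dV -mulNr opprB.
(* These [r] and [s] solve [r + i s = 1] and [r - i s = - 2 a], so that [r^2 + s^2 = - 2 a]. *)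
apply: (@twisted_case a ((1 - 2%:R * a) / 2%:R) (- i * (1 + 2%:R * a) / 2%:R) P Q x2 x3 x1) => //;
  rewrite ?tau1 ?tau2 ?tau3 ?lam1 ?lam2 ?lam3 ?PN ?QN ?PV ?QV ?opprK //.
- transitivity ((i ^+ 2 + 1) * ((1 + 2%:R * a) / 2%:R) ^+ 2); first by field.
  by rewrite i2 addNr mul0r.
- move=> m x mk; rewrite /P /Q.
  by rewrite !(rmorphB, rmorphD, rmorphM, fmorphV, rmorph1) /= !mk.
- move=> x /x_neq0 x0.
  transitivity ((I ^+ 2 + 1) * ((x + A / x) / 2%:R) ^+ 2); last first.
    by rewrite I2 addNr mul0r.
  by rewrite /P /Q -/A; field; rewrite two_neq0 x0.
- move=> x /x_neq0 x0; have [u uE] : exists u, u = P x by exists (P x).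
have [v vE] : exists v, v = Q x by exists (Q x).
rewrite -uE -vE.
  have gu : gen [:: u; v] u by apply: gen_mem; rewrite mem_head.
  have gv : gen [:: u; v] v by apply: gen_mem; rewrite !inE eqxx orbT.
  have gI : gen [:: u; v] I by apply: gen_cst.
  have -> : x = v - I * u.
    transitivity (v - I * u + (I ^+ 2 + 1) * ((x + A / x) / 2%:R)).
      by rewrite uE vE /P /Q; field; rewrite two_neq0 x0.
    by rewrite I2 addNr mul0r addr0.
  by gen_tac.
by rewrite (perm_rot 1 [:: x1; x2; x3]).
Qed.

End TwistedCases.

(** If [i] is not in [k], then [1] and [i] form a basis of [k(s, i)], and [s = u + v i]. Comparing
    coordinates in [s^2 = a] gives [u v = 0] and [u^2 - v^2 = a]. *)
Lemma deg_sqrt_a_i_square (k : fieldType) (a : k) :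
  2%:R != 0 :> k -> deg_sqrt_a_i_le2 a ->
  [\/ exists b, a = b ^+ 2, exists b, - a = b ^+ 2 | exists i : k, i ^+ 2 = -1].
Proof.
move=> two0 [L [s [i [s2 [i2 dimL]]]]].
have [/vlineP [c ic]|i1] := boolP (i \in <[1 : L]>%VS).
  constructor 3; exists c; apply: (fmorph_inj (in_alg L)).
  by rewrite rmorphN rmorph1 rmorphXn /= -ic.
pose V := <<1 & [:: s; i]>>%AS.
have Vi : i \in V by apply: seqv_sub_adjoin; rewrite !inE eqxx orbT.
have Vs : s \in V by apply: seqv_sub_adjoin; rewrite !inE eqxx.
have fr : free [:: i; 1 : L] by rewrite free_cons span_seq1 i1 seq1_free oner_neq0.
have spanV : (<<[:: i; 1%R]>> = V)%VS.
  apply/eqP; rewrite eqEdim; apply/andP; split.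
    by apply/span_subvP => x; rewrite !inE => /orP[]/eqP-> //; apply: mem1v.
  by move: fr; rewrite /free => /eqP ->.
have := Vs; rewrite -spanV span_cons => /memv_addP [x /vlineP [v ->]] [y].
rewrite span_seq1 => /vlineP [u ->] sE.
have E : (2%:R * u * v) *: i + (u ^+ 2 - v ^+ 2 - a) *: (1 : L) = 0.
  transitivity ((v *: i + u *: 1) ^+ 2 - a *: 1 - v ^+ 2 *: (i ^+ 2 + 1)).
    have scaleE (c : k) (w : L) : c *: w = in_alg L c * w by rewrite mulr_algl.
    by rewrite !scaleE; ring.
  by rewrite -sE s2 i2 subrr addNr scaler0 subr0.
have uv0 : 2%:R * u * v = 0.
  apply: contraNeq i1 => c0; apply/vlineP.
  exists (- (2%:R * u * v)^-1 * (u ^+ 2 - v ^+ 2 - a)).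
  apply: (scalerI c0); rewrite scalerA mulNr mulrN mulVKf // scaleNr.
  by apply/eqP; rewrite -addr_eq0 E.
move: E; rewrite uv0 scale0r add0r => /eqP.
rewrite scaler_eq0 oner_eq0 orbF subr_eq0 => /eqP uva.
move/eqP: uv0; rewrite !mulf_eq0 (negPf two0) /= => /orP[]/eqP z0.
  by constructor 2; exists v; rewrite -uva z0 expr0n sub0r opprK.
by constructor 1; exists u; rewrite -uva z0 expr0n subr0.
Qed.

(** * The theorem *)


(** Stated for any field generated over [k] by three independent elements; [X_indep] and [RF3_gen]
    specialize it to [RF3 k]. Being fixed by the three generators is being fixed by the group. *)
Lemma A4_fixed_field (k K : fieldType) (iota : {rmorphism k -> K}) (a e : k)
    (tau lam sig : {rmorphism K -> K}) (x1 x2 x3 : K) :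
  2%:R != 0 :> k -> a != 0 -> (e = 1 \/ (e = -1 /\ deg_sqrt_a_i_le2 a)) ->
  indep iota [::] [:: x1; x2; x3] -> (forall f, gen iota [:: x1; x2; x3] f) ->
  (forall c, tau (iota c) = iota c) -> (forall c, lam (iota c) = iota c) ->
  (forall c, sig (iota c) = iota c) ->
  tau x1 = iota a / x1 -> tau x2 = iota e * (iota a / x2) ->
  tau x3 = iota e * x3 ->
  lam x1 = iota e * (iota a / x1) -> lam x2 = iota e * x2 ->
  lam x3 = iota a / x3 ->
  sig x1 = x2 -> sig x2 = x3 -> sig x3 = x1 ->
  exists T1 T2 T3, indep iota [::] [:: T1; T2; T3] /\
    forall f, tau f = f /\ lam f = f /\ sig f = f <->
              gen iota [:: T3; T2; T1] f.
Proof.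
move=> two0 a0 e_cases x_indep x_gen tauk lamk sigk.
have two0K : 2%:R != 0 :> K by rewrite -(rmorph_nat iota) fmorph_eq0.
case: e_cases => [->|[-> /(deg_sqrt_a_i_square two0) sq]].
  rewrite rmorph1 !mul1r; exact: (split_fixed_field two0K a0 x_indep x_gen).
rewrite rmorphN rmorph1 !mulN1r => t1 t2 t3 l1 l2 l3 s1 s2 s3.
case: sq => [[b ab]|[b ab]|[i i2]].
- exact: (twisted_case_sqr two0K a0 x_indep x_gen tauk lamk sigk
    t1 t2 t3 l1 l2 l3 s1 s2 s3 ab).
- exact: (twisted_case_sqrN two0K a0 x_indep x_gen tauk lamk sigk
    t1 t2 t3 l1 l2 l3 s1 s2 s3 ab).
exact: (twisted_case_i two0K a0 x_indep x_gen tauk lamk sigk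
  t1 t2 t3 l1 l2 l3 s1 s2 s3 i2).
Qed.

Theorem theorem1p7 (k : fieldType) (a e : k) :
  (2%:R : k) != 0 -> a != 0 ->
  (e = 1 \/ (e = -1 /\ deg_sqrt_a_i_le2 a)) ->
  forall tau lam sig : {rmorphism RF3 k -> RF3 k},
    fixes_k tau -> fixes_k lam -> fixes_k sig ->
    tau (X1 k) = cst a / X1 k ->
    tau (X2 k) = cst e * (cst a / X2 k) ->
    tau (X3 k) = cst e * X3 k ->
    lam (X1 k) = cst e * (cst a / X1 k) ->
    lam (X2 k) = cst e * X2 k ->
    lam (X3 k) = cst a / X3 k ->
    sig (X1 k) = X2 k -> sig (X2 k) = X3 k -> sig (X3 k) = X1 k ->
    k_rational (fun f : RF3 k => tau f = f /\ lam f = f /\ sig f = f).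
Proof.
move=> two0 a0 e_cases tau lam sig tauk lamk sigk t1 t2 t3 l1 l2 l3 s1 s2 s3.
have [T1 [T2 [T3 [T_indep FE]]]] := A4_fixed_field two0 a0 e_cases (X_indep k)
  (@RF3_gen k) tauk lamk sigk t1 t2 t3 l1 l2 l3 s1 s2 s3.
exact: k_rational_gen T_indep FE.
Qed.
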